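(* Let $C_b^{\mathrm{it}}=[S_1,[S_2,b]]=[S_2,[S_1,b]]$ be the iterated commutator of the dyadic shifts $S_1,S_2$ with multiplication by $b$ on $L^2(\mathbb{R}^2)$. Then $$\|b\|_{\mathrm{BMO}_{\mathrm{rec}}}\lesssim\|C_b^{\mathrm{it}}\|_{L^2(\mathbb{R}^2)\to L^2(\mathbb{R}^2)},$$ with a constant independent of the symbol $b$.
   Context: $\mathcal{D}$ denotes the family of all dyadic intervals in $\mathbb{R}$. For $I\in\mathcal{D}$, $I_-$ and $I_+$ are its left and right halves, and $h_I=(\mathbf{1}_{I_+}-\mathbf{1}_{I_-})/\sqrt{|I|}$ is the $L^2$-normalized Haar function; $\{h_I\}_{I\in\mathcal{D}}$ is an orthonormal basis of $L^2(\mathbb{R})$. The shift $S$ is the linear operator determined by $h_{I_-}\mapsto -h_{I_+}$ and $h_{I_+}\mapsto h_{I_-}$ for all $I\in\mathcal{D}$, i.e. $Sf=\sum_{I\in\mathcal{D}}\big((f,h_{I_+})h_{I_-}-(f,h_{I_-})h_{I_+}\big)$. On functions of $(x_1,x_2)\in\mathbb{R}^2$, $S_i$ denotes $S$ acting in the variable $x_i$. The dyadic rectangular BMO norm is $$\|b\|_{\mathrm{BMO}_{\mathrm{rec}}}^2=\sup_R\frac1{|R|}\int_R\big|b(x_1,x_2)-\langle b\rangle_{R_2}(x_1)-\langle b\rangle_{R_1}(x_2)+\langle b\rangle_R\big|^2\,dx_1\,dx_2,$$ the supremum being over all dyadic rectangles $R=R_1\times R_2$, $R_1,R_2\in\mathcal{D}$,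 where $\langle b\rangle_{R_2}(x_1)=\frac1{|R_2|}\int_{R_2}b(x_1,x_2)\,dx_2$, $\langle b\rangle_{R_1}(x_2)=\frac1{|R_1|}\int_{R_1}b(x_1,x_2)\,dx_1$ and $\langle b\rangle_R=\frac1{|R|}\int_Rb$. Here $b\in L^2_{\mathrm{loc}}(\mathbb{R}^2)$, $[A,B]=AB-BA$ with $b$ identified with the operator of multiplication by $b$, so that $C_b^{\mathrm{it}}f=S_1S_2(bf)-S_1(b\,S_2f)-S_2(b\,S_1f)+b\,S_1S_2f$. This is understood initially on the dense subspace of finite linear combinations of the Haar functions $h_I\otimes h_J$, $I,J\in\mathcal{D}$; $\|C_b^{\mathrm{it}}\|_{L^2\to L^2}$ is the operator norm (equal to $+\infty$ if the operator is not bounded on this subspace). *)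

(* Defs.v *)
From HB Require Import structures.
From mathcomp Require Import all_boot all_order all_algebra finmap.
From mathcomp Require Import all_classical all_reals all_analysis.
Import Order.TTheory GRing.Theory Num.Theory.
Import numFieldNormedType.Exports.

Set Implicit Arguments.
Unset Strict Implicit.
Unset Printing Implicit Defensive.

Local Open Scope classical_set_scope.
Local Open Scope ring_scope.

Section HaarShift.
Variable R : realType.

Notation leb := (@lebesgue_measure R).

(* The measurable sets of the product are the Borel sets of the plane; every
   Lebesgue measurable function has a Borel representative, so this loses
   nothing for L^2(R^2) and L^2_loc(R^2). *)
Definition leb2 : {measure set (measurableTypeR R * measurableTypeR R) -> \bar R}
  := (leb \x leb)%E.

(* The pair (n, k) encodes the dyadic interval [k 2^n, (k+1) 2^n[. *)
Definition dyadic : choiceType := (int * int)%type.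

Definition dlen (I : dyadic) : R := 2 ^ I.1.

Definition dset (I : dyadic) : set R :=
  `[I.2%:~R * dlen I, (I.2 + 1)%:~R * dlen I[.

Definition dleft (I : dyadic) : dyadic := (I.1 - 1, I.2 * 2).
Definition dright (I : dyadic) : dyadic := (I.1 - 1, I.2 * 2 + 1).

Definition haar (I : dyadic) (x : R) : R :=
  (\1_(dset (dright I)) x - \1_(dset (dleft I)) x) / Num.sqrt (dlen I).

Definition inner (u v : R -> R) : R := Rintegral leb setT (fun t => u t * v t).

Definition L2 (f : R * R -> R) : Prop := f \in Lfun leb2 2%:E.

Definition normL2 (f : R * R -> R) : \bar R := Lnorm leb2 2%:E (EFin \o f).

Definition L2loc (b : R * R -> R) : Prop :=
  measurable_fun [set: measurableTypeR R * measurableTypeR R] b /\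
  forall K : set (R * R), compact K ->
    (\int[leb2]_(x in K) (`|b x| ^+ 2)%:E < +oo)%E.

(* g is the unconditional sum, in the norm of L^2(R^2), of the family F. *)
Definition is_L2sum (F : dyadic -> R * R -> R) (g : R * R -> R) : Prop :=
  L2 g /\
  forall e : R, 0 < e -> exists A0 : {fset dyadic},
    forall A : {fset dyadic}, fsubset A0 A ->
      (normL2 (fun x => g x - \sum_(I <- A) F I x)%R < e%:E)%E.

(* A representative of the sum; it is determined almost everywhere when the
   sum exists, and is 0 by convention otherwise. *)
Definition L2sum (F : dyadic -> R * R -> R) : R * R -> R :=
  xget (fun=> 0) [set g | is_L2sum F g].

(* The shift acting in one variable, as an operator on L^2(R^2): the Haar
   coefficients are taken in that variable for (almost every) fixed value of
   the other one, and the series over I converges in L^2(R^2). *)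
Definition shift1 (f : R * R -> R) : R * R -> R :=
  L2sum (fun I x =>
    inner (fun t => f (t, x.2)) (haar (dright I)) * haar (dleft I) x.1
    - inner (fun t => f (t, x.2)) (haar (dleft I)) * haar (dright I) x.1).

Definition shift2 (f : R * R -> R) : R * R -> R :=
  L2sum (fun I x =>
    inner (fun t => f (x.1, t)) (haar (dright I)) * haar (dleft I) x.2
    - inner (fun t => f (x.1, t)) (haar (dleft I)) * haar (dright I) x.2).

Definition mulop (b f : R * R -> R) : R * R -> R := fun x => b x * f x.

Definition comm (A B : (R * R -> R) -> (R * R -> R)) (f : R * R -> R) :
    R * R -> R :=
  fun x => A (B f) x - B (A f) x.

Definition Cit (b : R * R -> R) : (R * R -> R) -> (R * R -> R) :=
  comm shift1 (comm shift2 (mulop b)).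

Definition haar_span : set (R * R -> R) :=
  [set f | exists (A : {fset (dyadic * dyadic)%type})
                  (c : dyadic * dyadic -> R),
     f = fun x => \sum_(p <- A) c p * (haar p.1 x.1 * haar p.2 x.2)].

(* Norm of an operator initially defined on the span of the Haar functions;
   +oo when it is not bounded there. *)
Definition opnorm (T : (R * R -> R) -> (R * R -> R)) : \bar R :=
  ereal_sup [set normL2 (T f) | f in haar_span `&` [set f | (normL2 f <= 1)%E]].

(* avg2 averages out the second variable, avg1 the first one. *)
Definition avg2 (b : R * R -> R) (J : dyadic) (x1 : R) : R :=
  (dlen J)^-1 * Rintegral leb (dset J) (fun t => b (x1, t)).

Definition avg1 (b : R * R -> R) (I : dyadic) (x2 : R) : R :=
  (dlen I)^-1 * Rintegral leb (dset I) (fun t => b (t, x2)).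

Definition avg (b : R * R -> R) (I J : dyadic) : R :=
  (dlen I * dlen J)^-1 * Rintegral leb2 (dset I `*` dset J) b.

Definition BMOrec (b : R * R -> R) : \bar R :=
  sqrte (ereal_sup
    [set ((dlen p.1 * dlen p.2)^-1%:E *
          \int[leb2]_(x in dset p.1 `*` dset p.2)
            (`|b x - avg2 b p.2 x.1 - avg1 b p.1 x.2 + avg b p.1 p.2| ^+ 2)%:E)%E
    | p in [set: dyadic * dyadic]]).

End HaarShift.

(* Main.v *)
Require Import Defs.
From mathcomp Require Import all_boot all_order all_algebra finmap.
From mathcomp Require Import all_classical all_reals all_analysis.
From mathcomp Require Import measurable_realfun ring lra zify.
Import Order.TTheory GRing.Theory Num.Theory.
Import numFieldNormedType.Exports.

(** Let I, I' be the two halves of a dyadic interval, and J, J' those of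
    another one. On I' x J' only the terms of the Haar series exchanging I with
    I' and J with J' contribute to the commutator applied to h_I (x) h_J, so
    that it equals there, up to sign,
      (b - <b>_I(x_2) - <b>_J(x_1) + <b>_(I x J)) h_I'(x_1) h_J'(x_2).
    Hence the mean over I' x J' of the square of the first factor is at most the
    squared norm of the commutator. Since the mean of a function is its best
    constant approximation in L^2, applying this in each variable separately
    shows that replacing the averages over I and J by those over I' and J' can
    only decrease the integral. Every dyadic rectangle is of the form I' x J',
    and the inequality holds with constant 1. *)

Set Implicit Arguments.
Unset Strict Implicit.
Unset Printing Implicit Defensive.

Local Open Scope classical_set_scope.
Local Open Scope ring_scope.

(** * Square-integrable functions *)

(** A term of the series for S indexed by Q reads a coefficient on one half of Q and writes on the
    other half. If the input lives on I and the output is read on the sibling I', then Q separates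
    the two, so it is their parent; on I itself many shorter Q would contribute. The averages come
    from [h_I ^ 2 = 1_I / |I|]: pairing b h_I with h_I gives the mean of b over I, and each of the
    four products in the commutator yields one of the four terms of the mixed difference. The same
    identity on I' x J' produces the factor 1 / (|I'| |J'|) of the BMO mean, and the test function
    has norm 1: hence the constant 1. The obstacle is that [shift1] and [shift2] are
    representatives, picked by choice, of sums in L^2. Existence of the sums comes first, by
    orthogonality and Bessel's inequality; their values are then identified on a region where the
    finite partial sums are eventually stationary. All formulas hold up to null sets, which must be
    sliced before the second shift is applied. *)

Section SquareIntegrable.
Context d (T : measurableType d) (R : realType).
Variable mu : {measure set T -> \bar R}.
Implicit Types f g : T -> R.

Lemma ae_mono (P Q : T -> Prop) : (forall x, P x -> Q x) ->
  {ae mu, forall x, P x} -> {ae mu, forall x, Q x}.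
Proof. by move=> PQ; apply: filterS. Qed.

Lemma ae_mono2 (P Q S : T -> Prop) : (forall x, P x -> Q x -> S x) ->
  {ae mu, forall x, P x} -> {ae mu, forall x, Q x} -> {ae mu, forall x, S x}.
Proof. by move=> PQ; apply: filterS2. Qed.

Lemma Lnorm2E f :
  Lnorm mu 2%:E (EFin \o f) = sqrte (\int[mu]_x (f x ^+ 2)%:E)%E.
Proof.
rewrite unlock -poweR12_sqrt; last first.
  by apply: integral_ge0 => x _; rewrite lee_fin sqr_ge0.
congr (_ `^ _)%E; apply: eq_integral => x _ /=.
by rewrite powR_mulrn// -normrX ger0_norm// sqr_ge0.
Qed.

Lemma Lfun2P f : f \in Lfun mu 2%:E <->
  measurable_fun setT f /\ (\int[mu]_x (f x ^+ 2)%:E < +oo)%E.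
Proof.
have I0 : (0 <= \int[mu]_x (f x ^+ 2)%:E)%E.
  by apply: integral_ge0 => x _; rewrite lee_fin sqr_ge0.
split.
  move=> f2; have /integrableP[_] := Lfun2_integrable_sqr f2.
  under eq_integral do rewrite gee0_abs ?lee_fin ?sqr_ge0//.
  by move=> ?; split => //; move: f2; rewrite inE => /andP[/[!inE]].
move=> [mf If]; rewrite inE; apply/andP; rewrite !inE; split => //=.
rewrite /finite_norm Lnorm2E -poweR12_sqrt//; exact: poweR_lty.
Qed.

Definition dotp f g : R := \int[mu]_x (f x * g x).

Lemma Lfun2_mul_integrable f g : f \in Lfun mu 2%:E -> g \in Lfun mu 2%:E ->
  mu.-integrable setT (EFin \o (fun x => f x * g x)).
Proof. by move=> f2 g2; apply/Lfun1_integrable; exact: Lfun2_mul_Lfun1. Qed.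

Lemma Lfun2_measurable f : f \in Lfun mu 2%:E -> measurable_fun setT f.
Proof. by case/Lfun2P. Qed.

Let p1 : (1 <= 2%:E :> \bar R)%E. Proof. by rewrite lee_fin ler1n. Qed.

Lemma Lfun2D f g : f \in Lfun mu 2%:E -> g \in Lfun mu 2%:E ->
  (fun x => f x + g x) \in Lfun mu 2%:E.
Proof. by move=> f2 g2; exact: (@rpredD _ (Lfun mu 2%:E) f g f2 g2). Qed.

Lemma Lfun2Z (a : R) f : f \in Lfun mu 2%:E ->
  (fun x => a * f x) \in Lfun mu 2%:E.
Proof. by move=> f2; exact: (@rpredZ _ _ (Lfun mu 2%:E) a f f2). Qed.

Lemma Lfun2B f g : f \in Lfun mu 2%:E -> g \in Lfun mu 2%:E ->
  (fun x => f x - g x) \in Lfun mu 2%:E.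
Proof. by move=> f2 g2; exact: (@rpredB _ (Lfun mu 2%:E) f g f2 g2). Qed.

Lemma Lfun2_sum (I : Type) (r : seq I) (F : I -> T -> R) :
  (forall i, F i \in Lfun mu 2%:E) ->
  (fun x => \sum_(i <- r) F i x) \in Lfun mu 2%:E.
Proof.
move=> F2; rewrite (_ : (fun _ => _) = \sum_(i <- r) F i); last first.
  by apply/funext => x; rewrite fct_sumE.
exact: (@rpred_sum _ (Lfun mu 2%:E)).
Qed.

Lemma dotpC f g : dotp f g = dotp g f.
Proof. by apply: eq_Rintegral => x _; rewrite mulrC. Qed.

Lemma dotpE f : f \in Lfun mu 2%:E ->
  (dotp f f)%:E = (\int[mu]_x (f x ^+ 2)%:E)%E.
Proof.
move=> f2; have If := Lfun2_integrable_sqr f2.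
rewrite /dotp /Rintegral fineK//; exact: (integrable_fin_num _ If).
Qed.

Lemma dotpDl f g h : f \in Lfun mu 2%:E -> g \in Lfun mu 2%:E ->
  h \in Lfun mu 2%:E -> dotp (fun x => f x + g x) h = dotp f h + dotp g h.
Proof.
move=> f2 g2 h2; rewrite /dotp.
under eq_Rintegral do rewrite mulrDl.
by rewrite RintegralD//; exact: Lfun2_mul_integrable.
Qed.

Lemma dotpBl f g h : f \in Lfun mu 2%:E -> g \in Lfun mu 2%:E ->
  h \in Lfun mu 2%:E -> dotp (fun x => f x - g x) h = dotp f h - dotp g h.
Proof.
move=> f2 g2 h2; rewrite /dotp.
under eq_Rintegral do rewrite mulrBl.
by rewrite RintegralB//; exact: Lfun2_mul_integrable.
Qed.

Lemma dotpZl a f g : f \in Lfun mu 2%:E -> g \in Lfun mu 2%:E ->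
  dotp (fun x => a * f x) g = a * dotp f g.
Proof.
move=> f2 g2; rewrite /dotp.
under eq_Rintegral do rewrite -mulrA.
by rewrite RintegralZl//; exact: Lfun2_mul_integrable.
Qed.

Lemma dotpBB f g f' g' : f \in Lfun mu 2%:E -> g \in Lfun mu 2%:E ->
  f' \in Lfun mu 2%:E -> g' \in Lfun mu 2%:E ->
  dotp (fun x => f x - g x) (fun x => f' x - g' x) =
  dotp f f' - dotp f g' - (dotp g f' - dotp g g').
Proof.
move=> f2 g2 f'2 g'2; rewrite dotpBl//; last exact: Lfun2B.
rewrite (dotpC f) (dotpC g) !dotpBl//.
by rewrite !(dotpC f') !(dotpC g').
Qed.

Lemma dotp0l g : dotp (fun=> 0) g = 0.
Proof.
by rewrite /dotp; under eq_Rintegral do rewrite mul0r; rewrite /Rintegral integral0.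
Qed.

Lemma dotp_suml (I : Type) (r : seq I) (F : I -> T -> R) g :
  (forall i, F i \in Lfun mu 2%:E) -> g \in Lfun mu 2%:E ->
  dotp (fun x => \sum_(i <- r) F i x) g = \sum_(i <- r) dotp (F i) g.
Proof.
move=> F2 g2; elim: r => [|i r IH].
  by rewrite big_nil; under [X in dotp X]eq_fun do rewrite big_nil; exact: dotp0l.
under [X in dotp X]eq_fun do rewrite big_cons.
by rewrite dotpDl ?big_cons ?IH//; exact: Lfun2_sum.
Qed.

(** The scalars [s] allow a difference of two finite sums to be treated as one sum, with
    coefficients -1, 0 or 1. *)
Lemma pythagoras (I : eqType) (r : seq I) (F : I -> T -> R) (s : I -> R) :
  uniq r -> (forall i, F i \in Lfun mu 2%:E) ->
  (forall i j, i != j -> dotp (F i) (F j) = 0) ->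
  let S := fun x => \sum_(i <- r) s i * F i x in
  dotp S S = \sum_(i <- r) s i ^+ 2 * dotp (F i) (F i).
Proof.
move=> + F2 F0 /=; have sF2 i : (fun x => s i * F i x) \in Lfun mu 2%:E.
  exact: Lfun2Z.
have S2 r' : (fun x => \sum_(i <- r') s i * F i x) \in Lfun mu 2%:E.
  exact: Lfun2_sum.
move=> ur; rewrite dotp_suml// [LHS]big_seq [RHS]big_seq.
apply: eq_bigr => i ir; rewrite dotpZl// dotpC dotp_suml//.
rewrite (bigD1_seq i)//= big1 ?addr0; last first.
  by move=> j ji; rewrite dotpZl// F0// mulr0.
by rewrite dotpZl// mulrA expr2.
Qed.

(** Expand the square in [0 <= |f - S|^2], where [S] is the partial Haar-type expansion of [f]. The
    bound lives in [\bar R] and is trivial when [f] has infinite norm, so that it applies to every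
    slice of a function of two variables. *)
Lemma bessel (I : eqType) (r : seq I) (e : I -> T -> R) f :
  uniq r -> measurable_fun setT f -> (forall i, e i \in Lfun mu 2%:E) ->
  (forall i j, dotp (e i) (e j) = (i == j)%:R) ->
  ((\sum_(i <- r) dotp f (e i) ^+ 2)%:E <= \int[mu]_x (f x ^+ 2)%:E)%E.
Proof.
move=> ur mf e2 eo; have [f2|] := ltP (\int[mu]_x (f x ^+ 2)%:E)%E +oo%E; last first.
  by rewrite leye_eq => /eqP ->; rewrite leey.
have {mf}f2 : f \in Lfun mu 2%:E by apply/Lfun2P.
pose S x := \sum_(i <- r) dotp f (e i) * e i x.
have S2 : S \in Lfun mu 2%:E by apply: Lfun2_sum => i; exact: Lfun2Z.
have SS : dotp S S = \sum_(i <- r) dotp f (e i) ^+ 2.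
  rewrite pythagoras//; last by move=> i j /negbTE ij; rewrite eo ij.
  by apply: eq_bigr => i _; rewrite eo eqxx mulr1.
have Sf : dotp S f = \sum_(i <- r) dotp f (e i) ^+ 2.
  rewrite dotp_suml//; last by move=> i; exact: Lfun2Z.
  by apply: eq_bigr => i _; rewrite dotpZl// dotpC expr2.
rewrite -dotpE// lee_fin -SS.
have : 0 <= dotp (fun x => f x - S x) (fun x => f x - S x).
  by apply: Rintegral_ge0 => x _; rewrite -expr2 sqr_ge0.
have -> : (fun x => f x - S x) = (fun x => f x + (-1) * S x).
  by apply/funext => x; rewrite mulN1r.
have NS2 : (fun x => (-1) * S x) \in Lfun mu 2%:E by exact: Lfun2Z.
have fS2 : (fun x => f x + (-1) * S x) \in Lfun mu 2%:E by exact: Lfun2D.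
rewrite dotpDl// dotpZl// [dotp f _]dotpC [dotp S _]dotpC !dotpDl// !dotpZl//.
rewrite Sf [dotp f S]dotpC Sf SS.
set a := dotp f f; set b := \sum_(i <- r) _; lra.
Qed.

End SquareIntegrable.

(** * Unconditional convergence of orthogonal series *)

Section OrthogonalSeries.
Context d (T : measurableType d) (R : realType).
Variable mu : {measure set T -> \bar R}.

Lemma measurable_sqr (f : T -> R) : measurable_fun setT f ->
  measurable_fun setT (EFin \o (fun x => f x ^+ 2)).
Proof. by move=> mf; apply/measurable_EFinP; exact: measurable_funX. Qed.

(** Weighted by [4 ^+ n], the squared increments have integrals at most [2 ^- n], so their sum [W]
    is finite almost everywhere; there the increments are at most [sqrt W * 2 ^- n] and telescope.
    Thus 8 = 4 * 2: the factor 4 gives pointwise decay, the factor 2 summability of the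
    integrals. *)
Lemma fast_cauchy_ae_cvg (g : nat -> T -> R) :
  (forall n, measurable_fun setT (g n)) ->
  (forall n, (\int[mu]_x ((g n.+1 x - g n x) ^+ 2)%:E <= ((8 ^- n) : R)%:E)%E) ->
  {ae mu, forall x, cvgn (g ^~ x)}.
Proof.
move=> mg g8.
pose f n x : \bar R := (4 ^+ n * (g n.+1 x - g n x) ^+ 2)%:E.
have f0 n x : (0 <= f n x)%E.
  by rewrite lee_fin; apply: mulr_ge0; [exact: exprn_ge0|exact: sqr_ge0].
have md n : measurable_fun setT (fun x => g n.+1 x - g n x).
  exact: measurable_funB.
have mf n : measurable_fun setT (f n).
  apply/measurable_EFinP; apply: measurable_funM => //.
  exact: measurable_funX.
pose W x : \bar R := (\sum_(n <oo) f n x)%E.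
have mW : measurable_fun setT W.
  by apply: ge0_emeasurable_sum.
have W0 x : (0 <= W x)%E by exact: nneseries_ge0.
have IW : (\int[mu]_x W x < +oo)%E.
  rewrite /W integral_nneseries//.
  apply: (@le_lt_trans _ _ 2%:E); last by rewrite ltry.
  have -> : (2 : R)%:E = (\sum_(k <oo) (2 / (2 ^ (k + 1))%:R)%:E)%E.
    apply/esym/cvg_lim => //.
    by have := @cvg_geometric_eseries_half R 2 0; rewrite expr0 divr1.
  apply: lee_nneseries => [n _ _|n _]; first exact: integral_ge0.
  rewrite /f; under eq_integral do rewrite EFinM.
  rewrite ge0_integralZl_EFin ?exprn_ge0//; last first.
  - exact: measurable_sqr.
  - by move=> x _; rewrite lee_fin sqr_ge0.
  apply: (le_trans (lee_wpmul2l _ (g8 n))); first by rewrite lee_fin exprn_ge0.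
  rewrite -EFinM lee_fin addn1 natrX.
  have -> : (8 : R) = 4 * 2 by rewrite -natrM.
  rewrite exprMn invfM mulrA divff ?mul1r; last by rewrite expf_neq0.
  by rewrite exprS invfM mulrA divff// mul1r.
have iW : mu.-integrable setT W.
  apply/integrableP; split => //.
  by under eq_integral do rewrite gee0_abs//.
have := integrable_ae measurableT iW; apply: filterS => x /(_ I) Wfin.
pose M := fine (W x).
have M0 : 0 <= M by exact: fine_ge0.
have dM n : `|g n.+1 x - g n x| <= geometric (Num.sqrt M) (2^-1) n.
  have fM : (f n x <= W x)%E.
    rewrite /W; apply: le_trans (nneseries_lim_ge n.+1 _) => //.
    by rewrite big_nat_recr//= leeDr// sume_ge0.
  rewrite -(fineK Wfin) lee_fin in fM.
  rewrite /= exprVn ler_pdivlMr ?exprn_gt0//.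
  rewrite -(@ler_pXn2r _ 2)// ?nnegrE ?mulr_ge0 ?exprn_ge0 ?sqrtr_ge0//.
  rewrite sqr_sqrtr// exprMn real_normK ?num_real// mulrC -exprM mulnC exprM.
  by rewrite (_ : 2 ^+ 2 = 4)// -natrX.
have : cvgn (series (fun n => g n.+1 x - g n x)).
  apply: normed_cvg; apply: (series_le_cvg _ _ dM) => //.
    by move=> n; rewrite /= mulr_ge0 ?sqrtr_ge0// exprn_ge0// invr_ge0.
  by apply: is_cvg_geometric_series; rewrite ger0_norm ?invf_lt1// ?invr_ge0// ltr1n.
move=> cs; rewrite (_ : g ^~ x = (fun n => series (fun n => g n.+1 x - g n x) n + g 0%N x)).
  by apply: is_cvgD => //; exact: is_cvg_cst.
apply/funext => n; rewrite /series/=.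
by rewrite (telescope_sumr (fun k => g k x))// subrK.
Qed.

(** The upper limit in [\bar R] is measurable on the whole space and coincides with the limit
    wherever the latter exists; [fine] brings it back to [R]. *)
Lemma ae_limit_measurable (g : nat -> T -> R) :
  (forall n, measurable_fun setT (g n)) ->
  {ae mu, forall x, cvgn (g ^~ x)} ->
  exists2 G : T -> R, measurable_fun setT G &
    {ae mu, forall x, g ^~ x @ \oo --> G x}.
Proof.
move=> mg cg; exists (fun x => fine (limn_esup (fun n => (g n x)%:E))).
  apply: (@measurableT_comp _ _ _ _ _ _ fine) => //.
  apply: (@measurable_fun_limn_esup _ _ _ setT (fun n x => (g n x)%:E)) => n.
  exact/measurable_EFinP.
apply: filterS cg => x /cvg_ex[l gl].
have gl' : (fun n => (g n x)%:E) @ \oo --> l%:E.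
  by apply: cvg_EFin => //; exact: nearW.
by have [_ ->] := cvg_limn_einf_sup gl'.
Qed.

(** Fatou's lemma for the sequence started at [N], where the bound begins to hold. It upgrades
    almost everywhere convergence to a bound in L^2. *)
Lemma fatou_sqr (g : nat -> T -> R) (G h : T -> R) N (c : \bar R) :
  (forall n, measurable_fun setT (g n)) -> measurable_fun setT G ->
  measurable_fun setT h -> {ae mu, forall x, g ^~ x @ \oo --> G x} ->
  (forall n, (N <= n)%N -> (\int[mu]_x ((g n x - h x) ^+ 2)%:E <= c)%E) ->
  (\int[mu]_x ((G x - h x) ^+ 2)%:E <= c)%E.
Proof.
move=> mg mG mh gG gc.
have mgh n : measurable_fun setT (EFin \o (fun x => (g n x - h x) ^+ 2)).
  by apply: measurable_sqr; exact: measurable_funB.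
have mGh : measurable_fun setT (EFin \o (fun x => (G x - h x) ^+ 2)).
  by apply: measurable_sqr; exact: measurable_funB.
pose F n x : \bar R := ((g (n + N)%N x - h x) ^+ 2)%:E.
have mF n : measurable_fun setT (F n) by exact: mgh.
have F0 n x : (0 <= F n x)%E by rewrite lee_fin sqr_ge0.
have F0' x : (0 <= limn_einf (F ^~ x))%E.
  rewrite limn_einf_lim; apply: lime_ge; first exact: is_cvg_einfs.
  by apply: nearW => n; apply: le_ereal_inf_tmp => _ [m /= _ <-].
rewrite (@ge0_ae_eq_integral _ _ _ mu setT _ (fun x => limn_einf (F ^~ x)))//.
- apply: (le_trans (@fatou _ T R mu setT measurableT F _ _)) => //.
  rewrite limn_einf_lim; apply: lime_le; first exact: is_cvg_einfs.
  apply: nearW => n; apply: ge_ereal_inf.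
  exists (\int[mu]_x F n x)%E; first by exists n => /=.
  exact/gc/leq_addl.
- rewrite /limn_einf; apply: measurableT_comp => //.
  apply: (@measurable_fun_limn_esup _ _ _ setT (fun n x => - F n x)%E) => n.
  exact: measurableT_comp.
- by move=> x _; rewrite lee_fin sqr_ge0.
- apply: filterS gG => x gx _.
  have gh : (fun n => g (n + N)%N x - h x) @ \oo --> G x - h x.
    apply: cvgB; last exact: cvg_cst.
    by have := gx; rewrite -(cvg_shiftn N).
  have gx' : F ^~ x @ \oo --> ((G x - h x) ^+ 2)%:E.
    apply: cvg_EFin; first exact: nearW.
    rewrite expr2 (_ : fine \o _ = (fun n => (g (n + N)%N x - h x) * (g (n + N)%N x - h x))).
      exact: cvgM.
    by apply/funext => n /=; rewrite -expr2.
  by have [-> _] := cvg_limn_einf_sup gx'.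
Qed.

(** Riesz-Fischer for an arbitrary index type. Finite sets nearly attaining the supremum of the
    energy leave little energy outside, so any two finite sums over larger sets are close. A fast
    subsequence converges almost everywhere to [G], and Fatou's lemma compares [G] with every finite
    sum over a large set. *)
Lemma orthogonal_series_cvg (I : choiceType) (F : I -> T -> R) (M : R) :
  (forall i, F i \in Lfun mu 2%:E) ->
  (forall i j, i != j -> dotp mu (F i) (F j) = 0) ->
  (forall A : {fset I}, \sum_(i <- A) dotp mu (F i) (F i) <= M) ->
  exists2 G : T -> R, G \in Lfun mu 2%:E &
    forall e : R, 0 < e -> exists A0 : {fset I}, forall A : {fset I},
      fsubset A0 A ->
      (\int[mu]_x ((G x - \sum_(i <- A) F i x) ^+ 2)%:E <= e%:E)%E.
Proof.
move=> F2 Fo FM; pose a i := dotp mu (F i) (F i).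
have a0 i : 0 <= a i by apply: Rintegral_ge0 => x _; rewrite -expr2 sqr_ge0.
pose E := [set \sum_(i <- A : {fset I}) a i | A in [set: {fset I}]].
have supE : has_sup E.
  split; first by exists (\sum_(i <- fset0) a i); exists fset0.
  by exists M => _ [A _ <-].
have /choice[A_ A_P] n : exists A : {fset I}, sup E - 8 ^- n < \sum_(i <- A) a i.
  have e0 : (0 : R) < 8 ^- n by rewrite invr_gt0 exprn_gt0.
  by have [_ [A _ <-] ?] := sup_adherent e0 supE; exists A.
(* The unions make the sets increasing and remain near-optimal, since they contain [A_ n]. *)
pose fix B n : {fset I} := if n is m.+1 then fsetU (B m) (A_ n) else A_ 0%N.
have AB n : fsubset (A_ n) (B n).
  by case: n => [|n] /=; [exact: fsubset_refl|exact: fsubsetUr].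
have BS m n : (m <= n)%N -> fsubset (B m) (B n).
  elim: n => [|n IH]; first by rewrite leqn0 => /eqP ->; exact: fsubset_refl.
  rewrite leq_eqVlt => /predU1P[->|]; first exact: fsubset_refl.
  by rewrite ltnS => /IH BmBn; apply: (fsubset_trans BmBn); exact: fsubsetUl.
have aS (A A' : {fset I}) : fsubset A A' ->
    \sum_(i <- A) a i = \sum_(i <- A') (i \in A)%:R * a i.
  move=> AA'; rewrite (eq_big_seq (fun i => (i \in A)%:R * a i)); last first.
    by move=> i /= ->; rewrite mul1r.
  by apply: big_fset_incl => // i _ /negbTE ->; rewrite mul0r.
have sumS (A A' : {fset I}) x : fsubset A A' ->
    \sum_(i <- A) F i x = \sum_(i <- A') (i \in A)%:R * F i x.
  move=> AA'; rewrite (eq_big_seq (fun i => (i \in A)%:R * F i x)); last first.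
    by move=> i /= ->; rewrite mul1r.
  by apply: big_fset_incl => // i _ /negbTE ->; rewrite mul0r.
have S2 (A : {fset I}) : (fun x => \sum_(i <- A) F i x) \in Lfun mu 2%:E.
  exact: Lfun2_sum.
(* The coefficients of the difference vanish on [B n] and have square at most 1 elsewhere, so its
   energy is at most what lies outside [B n], which is less than [8 ^- n]. *)
have small n (A A' : {fset I}) : fsubset (B n) A -> fsubset (B n) A' ->
    (\int[mu]_x ((\sum_(i <- A) F i x - \sum_(i <- A') F i x) ^+ 2)%:E <=
     (8 ^- n)%:E)%E.
  move=> BA BA'; rewrite -dotpE; last exact: Lfun2B.
  rewrite lee_fin; pose U := fsetU A A'.
  have AU : fsubset A U by exact: fsubsetUl.
  have AU' : fsubset A' U by exact: fsubsetUr.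
  rewrite (_ : (fun _ => _) =
      (fun x => \sum_(i <- U) ((i \in A)%:R - (i \in A')%:R) * F i x)); last first.
    apply/funext => x; rewrite (sumS A U)// (sumS A' U)// -sumrB.
    by apply: eq_bigr => i _; rewrite mulrBl.
  rewrite (pythagoras _ (fset_uniq U) F2 Fo).
  have BU : fsubset (B n) U by exact: fsubset_trans AU.
  apply: (@le_trans _ _ (\sum_(i <- U) a i - \sum_(i <- B n) a i)).
    rewrite (aS _ _ BU) -sumrB; apply: ler_sum => i _.
    rewrite -[X in _ <= X - _]mul1r -mulrBl; apply: ler_wpM2r; first exact: a0.
    have [iB|iB] := boolP (i \in B n).
      by rewrite (fsubsetP BA _ iB) (fsubsetP BA' _ iB) !subrr expr0n.
    by case: (i \in A); case: (i \in A'); rewrite ?subrr ?subr0 ?sub0r ?sqrrN ?expr0n ?expr1n//=.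
  have U1 : \sum_(i <- U) a i <= sup E by apply: sup_upper_bound => //; exists U.
  have B1 : \sum_(i <- A_ n) a i <= \sum_(i <- B n) a i.
    rewrite (aS _ _ (AB n)); apply: ler_sum => i _.
    by apply: ler_piMl; [exact: a0|case: (_ \in _)].
  have := A_P n; lra.
pose g n x := \sum_(i <- B n) F i x.
have mg n : measurable_fun setT (g n) by apply: Lfun2_measurable; exact: S2.
have g8 n : (\int[mu]_x ((g n.+1 x - g n x) ^+ 2)%:E <= ((8 ^- n) : R)%:E)%E.
  by apply: small; [exact: BS|exact: fsubset_refl].
have [G mG gG] := ae_limit_measurable mg (fast_cauchy_ae_cvg mg g8).
have GA n (A : {fset I}) : fsubset (B n) A ->
    (\int[mu]_x ((G x - \sum_(i <- A) F i x) ^+ 2)%:E <= (8 ^- n)%:E)%E.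
  move=> BA; apply: (fatou_sqr (N := n) mg mG _ gG); first exact/Lfun2_measurable/S2.
  by move=> m nm; apply: small => //; exact: BS.
have G2 : G \in Lfun mu 2%:E.
  have G02 : (fun x => G x - g 0%N x) \in Lfun mu 2%:E.
    apply/Lfun2P; split; first exact: measurable_funB.
    by apply: (le_lt_trans (GA 0%N _ (fsubset_refl _))); rewrite ltry.
  rewrite (_ : G = (fun x => (G x - g 0%N x) + g 0%N x)); last first.
    by apply/funext => x; rewrite subrK.
  exact: (Lfun2D G02 (S2 (B 0%N))).
exists G => // e e0.
have [n ne] : exists n, (8 ^- n : R) <= e.
  have /cvgrPdist_lt /(_ _ e0)[n _ /(_ n (leqnn _))] :
      (fun n => (8^-1 : R) ^+ n) @ \oo --> 0.
    by apply: cvg_expr; rewrite ger0_norm ?invr_ge0// invf_lt1// ltr1n.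
  rewrite sub0r normrN ger0_norm ?exprn_ge0 ?invr_ge0// exprVn => /ltW ?.
  by exists n.
exists (B n) => A BA; apply: (le_trans (GA _ _ BA)).
by rewrite lee_fin.
Qed.

End OrthogonalSeries.

(** * Dyadic intervals and Haar functions *)

Section Haar.
Variable R : realType.
Implicit Types (I K : dyadic) (b : bool) (x : R).

Notation leb := (@lebesgue_measure R).

(** With halves indexed by a boolean, the sibling of [child b I] is [child (~~ b) I], and [sgn b] is
    both the sign of [haar I] on [child b I] and the sign in the rule sending the Haar function of
    [child b I] to that of its sibling. *)
Definition child b I : dyadic := if b then dright I else dleft I.

Definition sgn b : R := if b then 1 else -1.

Lemma dlen_gt0 I : 0 < dlen R I.
Proof. by rewrite /dlen exprz_gt0. Qed.
Hint Resolve dlen_gt0 : core.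

Lemma dlen_child b I : dlen R I = 2 * dlen R (child b I).
Proof.
have -> : dlen R (child b I) = 2 ^ (I.1 - 1) by case: b.
by rewrite /dlen expfzDr// mulrC divfK.
Qed.

Lemma dsetE I x : dset I x =
  (I.2%:~R * dlen R I <= x < (I.2 + 1)%:~R * dlen R I) :> Prop.
Proof. by rewrite /dset /= in_itv. Qed.

Lemma measurable_dset I : measurable (dset I : set (measurableTypeR R)).
Proof. exact: measurable_itv. Qed.

Lemma leb_dset I : leb (dset I) = (dlen R I)%:E.
Proof.
rewrite /dset lebesgue_measure_itv /= lte_fin.
rewrite ltr_pM2r// ltr_int ltrDl ltr01 -EFinD -mulrBl -intrB.
by rewrite [(_ + 1 - _)%R]addrAC subrr add0r mul1r.
Qed.

(** In units of the shorter length all endpoints are integers. The common point gives strict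
    inequalities between them, which integrality sharpens into the inclusion. *)
Lemma dset_nest I K x : (I.1 <= K.1)%R -> dset I x -> dset K x ->
  dset I `<=` @dset R K.
Proof.
case: I K => n k [m l] /= nm.
have [j mE] : exists j : nat, m = n + j%:Z.
  by exists `|m - n|%N; move: nm => /=; lia.
rewrite !dsetE /= /dlen /= => /andP[x1 x2] /andP[x3 x4] y; rewrite !dsetE.
have n0 : 0 < (2 : R) ^ n by rewrite exprz_gt0.
have N0 : (0 : int) < 2 ^+ j by rewrite exprn_gt0.
have mR : (2 : R) ^ m = (2 ^+ j)%:~R * 2 ^ n.
  by rewrite mE expfzDr// mulrC -exprnP rmorphXn.
rewrite /= /dlen /= !mR !mulrA -!intrM in x3 x4 *.
have /[!ltr_pM2r n0] h1 := le_lt_trans x3 x2.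
have /[!ltr_pM2r n0] h2 := le_lt_trans x1 x4.
rewrite !ltr_int in h1 h2; rewrite ltzD1 in h1.
move=> /andP[y1 y2]; apply/andP; split.
  by apply: le_trans y1; rewrite ler_pM2r// ler_int.
by apply: (lt_le_trans y2); rewrite ler_pM2r// ler_int lezD1.
Qed.

Lemma dset_inj I K x : I.1 = K.1 -> dset I x -> @dset R K x -> I = K.
Proof.
case: I K => n k [m l] /= <-.
rewrite !dsetE /= /dlen /= => /andP[x1 x2] /andP[x3 x4].
have n0 : 0 < (2 : R) ^ n by rewrite exprz_gt0.
have /[!ltr_pM2r n0] := le_lt_trans x3 x2.
have /[!ltr_pM2r n0] := le_lt_trans x1 x4.
rewrite !ltr_int !ltzD1 => h1 h2; congr pair.
by apply/eqP; rewrite eq_le h1 h2.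
Qed.

Lemma dset_childE I x : @dset R I x <-> exists b, dset (child b I) x.
Proof.
have cE b : dset (child b I) x =
    ((I.2 * 2 + b)%:~R * dlen R (child b I) <= x <
     (I.2 * 2 + b + 1)%:~R * dlen R (child b I)) :> Prop.
  by rewrite dsetE; case: b => /=; rewrite ?addr0.
have l0 b : dlen R (child b I) = 2 ^ (I.1 - 1) by case: b.
have lI : dlen R I = 2 * 2 ^ (I.1 - 1) by rewrite (dlen_child true) l0.
have p0 : 0 < (2 : R) ^ (I.1 - 1) by rewrite exprz_gt0.
split.
  rewrite dsetE lI => /andP[x1 x2].
  have [h|h] := ltP x ((I.2 * 2 + 1)%:~R * 2 ^ (I.1 - 1)).
    exists false; rewrite cE l0 addr0 h andbT.
    by apply: le_trans x1; rewrite mulrA intrM.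
  exists true; rewrite cE l0 h /=; apply: (lt_le_trans x2).
  by rewrite mulrA -(intrM _ _ 2) ler_pM2r// ler_int mulrDl -addrA.
move=> [b]; rewrite cE dsetE lI l0 !mulrA -!(intrM _ _ 2) => /andP[x1 x2].
apply/andP; split.
  by apply: le_trans x1; rewrite ler_pM2r// ler_int lerDl; case: (b).
apply: (lt_le_trans x2); rewrite ler_pM2r// ler_int mulrDl mul1r -addrA lerD2l.
by case: (b).
Qed.

Lemma dset_child b I : dset (child b I) `<=` @dset R I.
Proof. by move=> x xb; apply/dset_childE; exists b. Qed.

Lemma childN b I : child b I != child (~~ b) I.
Proof.
apply/eqP; case: b => -[] /eqP; rewrite ?(addrC _ 1) -subr_eq0 ?addrK//.
by rewrite opprD addrA addrAC subrr add0r oppr_eq0.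
Qed.

(** The parity of the position tells which half it is, and halving it recovers the parent. *)
Lemma child_inj b b' I K : child b I = child b' K -> b = b' /\ I = K.
Proof.
have cE c J : child c J = (J.1 - 1, J.2 * 2 + c) by case: c; rewrite ?addr0.
rewrite !cE; case: I K => n k [m l] /= -[nm kl].
have {nm}-> : n = m by lia.
have bb : b = b' by case: (b) (b') kl => -[]//=; lia.
by split=> //; congr pair; move: kl; rewrite bb; lia.
Qed.

Lemma dset_childN b I x : dset (child b I) x -> ~ @dset R (child (~~ b) I) x.
Proof.
move=> xb xnb; have /eqP := childN b I; apply.
by apply: (dset_inj (x := x)) => //; case: (b).
Qed.

Lemma indic_child b I x :
  haar I x = sgn b * (\1_(dset (child b I)) x - \1_(dset (child (~~ b) I)) x)
    / Num.sqrt (dlen R I).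
Proof. by rewrite /haar; case: b => /=; rewrite ?mul1r// mulN1r opprB. Qed.

Lemma haar_child b I x : dset (child b I) x ->
  haar I x = sgn b / Num.sqrt (dlen R I).
Proof.
move=> xb; rewrite (indic_child b) !indicE mem_set// memNset ?subr0 ?mulr1//.
exact: dset_childN.
Qed.

Lemma haar_out I x : ~ dset I x -> @haar R I x = 0.
Proof.
move=> xI; rewrite (indic_child true) !indicE !memNset ?subrr ?mulr0 ?mul0r//;
  by apply: contra_not xI; exact: dset_child.
Qed.

Lemma haar_sqr I x : @haar R I x ^+ 2 = (dlen R I)^-1 * \1_(dset I) x.
Proof.
have [xI|xI] := pselect (dset I x); last first.
  by rewrite haar_out// indicE memNset// mulr0 expr0n.
have /dset_childE[b xb] := xI.
rewrite (haar_child xb) exprMn exprVn sqr_sqrtr ?ltW// indicE mem_set// mulr1.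
by case: (b); rewrite ?sqrrN expr1n mul1r.
Qed.

(** By nesting, a strictly shorter interval that meets a half of [K] is contained in that half. *)
Lemma haar_const I K : (I.1 < K.1)%R ->
  exists c, forall x, dset I x -> @haar R K x = c.
Proof.
move=> IK; have [[b [x [xI xb]]]|no] :=
    pselect (exists b x, dset I x /\ @dset R (child b K) x).
  exists (sgn b / Num.sqrt (dlen R K)) => y yI; apply: haar_child.
  apply: (dset_nest _ xI xb) => //.
  by case: (b) => /=; rewrite lerBrDr lezD1.
exists 0 => x xI; apply: haar_out => /dset_childE[b xb]; apply: no.
by exists b, x.
Qed.

Lemma measurable_haar I : measurable_fun [set: measurableTypeR R] (@haar R I).
Proof.
apply: measurable_funM => //; apply: measurable_funB;
  by apply: measurable_indic; exact: measurable_dset.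
Qed.

Lemma integrable_indic_dset I :
  leb.-integrable setT (EFin \o \1_(@dset R I)).
Proof.
apply/integrableP; split.
  by apply/measurable_EFinP; apply: measurable_indic; exact: measurable_dset.
under eq_integral do rewrite /= ger0_norm//.
rewrite integral_indic//; last exact: measurable_dset.
by rewrite setIT [X in (X < _)%E]leb_dset ltry.
Qed.

Lemma Rintegral_indic_dset I : Rintegral leb setT \1_(@dset R I) = dlen R I.
Proof.
rewrite /Rintegral integral_indic//; last exact: measurable_dset.
by rewrite setIT [X in fine X]leb_dset.
Qed.

Lemma Lfun2_haar I : @haar R I \in Lfun leb 2%:E.
Proof.
apply/Lfun2P; split; first exact: measurable_haar.
under eq_integral do rewrite haar_sqr.
rewrite (_ : (\int[_]_x _)%E = (\int[leb]_x ((dlen R I)^-1%:E * (\1_(dset I) x)%:E))%E)//.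
rewrite ge0_integralZl_EFin ?invr_ge0 ?ltW//; last first.
  by apply/measurable_EFinP; apply: measurable_indic; exact: measurable_dset.
apply: lte_mul_pinfty; rewrite ?lee_fin ?invr_ge0 ?ltW//.
by have /integrable_lty := integrable_indic_dset I; exact.
Qed.

Lemma Rintegral_haar I : Rintegral leb setT (@haar R I) = 0.
Proof.
rewrite /haar; under eq_Rintegral do rewrite mulrC.
rewrite RintegralZl//; last first.
  rewrite (_ : EFin \o _ = (EFin \o \1_(@dset R (dright I))) \-
    (EFin \o \1_(@dset R (dleft I))))%E//.
  by apply: integrableB => //; exact: integrable_indic_dset.
rewrite RintegralB//; try exact: integrable_indic_dset.
by rewrite !Rintegral_indic_dset /dlen /= subrr mulr0.
Qed.

(** For different lengths the longer function is constant on the support of the shorter one, which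
    has mean zero; for equal lengths the supports are disjoint. *)
Lemma haar_orthonormal I K : dotp leb (haar I) (@haar R K) = (I == K)%:R.
Proof.
have E (J L : dyadic) : (J.1 < L.1)%R -> dotp leb (haar J) (@haar R L) = 0.
  move=> /haar_const[c cP].
  rewrite /dotp (@eq_Rintegral _ _ _ leb setT (fun x => c * haar J x)); last first.
    move=> x _; rewrite mulrC; have [xJ|xJ] := pselect (dset J x).
      by rewrite cP.
    by rewrite (haar_out xJ) !mulr0.
  rewrite RintegralZl ?Rintegral_haar ?mulr0//.
  have := integrableB measurableT (integrable_indic_dset (dright J))
    (integrable_indic_dset (dleft J)).
  move=> /(integrableZr measurableT (Num.sqrt (dlen R J))^-1).
  exact: eq_integrable.
have [->|IK] := eqVneq I K.
  rewrite /dotp; under eq_Rintegral do rewrite -expr2 haar_sqr.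
  rewrite RintegralZl//; last exact: integrable_indic_dset.
  by rewrite Rintegral_indic_dset mulVf// gt_eqF.
have [//|h|h] := ltgtP I.1 K.1; [exact: E|by rewrite dotpC E|].
rewrite /dotp (@eq_Rintegral _ _ _ leb setT (fun=> 0)) ?/Rintegral ?integral0// => x _.
have [xI|/haar_out ->] := pselect (dset I x); last by rewrite mul0r.
have [xK|/haar_out ->] := pselect (dset K x); last by rewrite mulr0.
by move/eqP: IK; case; exact: dset_inj xK.
Qed.

End Haar.
#[export] Hint Resolve dlen_gt0 : core.

(** * Products and exchange of variables *)

Section ProductMeasure.
Context d1 d2 (T1 : measurableType d1) (T2 : measurableType d2) (R : realType).
Variable m1 : {sigma_finite_measure set T1 -> \bar R}.
Variable m2 : {sigma_finite_measure set T2 -> \bar R}.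
Local Notation m12 := (m1 \x m2)%E.

Lemma ae_prod_slice1 (P : T1 * T2 -> Prop) : {ae m12, forall x, P x} ->
  {ae m1, forall x, {ae m2, forall y, P (x, y)}}.
Proof.
move=> [N [mN N0 PN]].
have mF : measurable_fun setT (fun x => m2 (xsection N x)).
  exact: measurable_fun_xsection.
have I0 : (\int[m1]_x `|m2 (xsection N x)| = 0)%E.
  by under eq_integral do rewrite gee0_abs//.
have /ae_eq_integral_abs : measurable_fun setT (fun x => m2 (xsection N x)) by [].
move=> /(_ m1 measurableT)/iffLR/(_ I0); apply: filterS => x /(_ I) /= Nx0.
exists (xsection N x); split => //; first exact: measurable_xsection.
by move=> y /= nP; rewrite /xsection /= inE; exact: PN.
Qed.

(** The product measure is defined through sections in one direction; uniqueness of the product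
    measure identifies it with the one built from the other sections. *)
Lemma ae_prod_slice2 (P : T1 * T2 -> Prop) : {ae m12, forall x, P x} ->
  {ae m2, forall y, {ae m1, forall x, P (x, y)}}.
Proof.
move=> [N [mN N0 PN]].
have mF : measurable_fun setT (fun y => m1 (ysection N y)).
  exact: measurable_fun_ysection.
have I0 : (\int[m2]_y `|m1 (ysection N y)| = 0)%E.
  under eq_integral do rewrite gee0_abs//.
  rewrite -[LHS]/(product_measure2 m1 m2 N) -N0; apply/esym.
  by apply: product_measure_unique => // B C mB mC/=; rewrite product_measure2E.
have /ae_eq_integral_abs : measurable_fun setT (fun y => m1 (ysection N y)) by [].
move=> /(_ m2 measurableT)/iffLR/(_ I0); apply: filterS => y /(_ I) /= Ny0.
exists (ysection N y); split => //; first exact: measurable_ysection.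
by move=> x /= nP; rewrite /ysection /= inE; exact: PN.
Qed.

Lemma ae_prod_fst (P : T1 -> Prop) :
  {ae m1, forall x, P x} -> {ae m12, forall x, P x.1}.
Proof.
move=> [N [mN N0 PN]]; exists (N `*` setT); split.
- exact: measurableX.
- transitivity (m1 N * m2 setT)%E; first exact: product_measure1E.
  by rewrite [m1 N]N0 mul0e.
- by move=> [x y] /= nP; split=> //; exact: PN.
Qed.

Lemma ae_prod_snd (P : T2 -> Prop) :
  {ae m2, forall x, P x} -> {ae m12, forall x, P x.2}.
Proof.
move=> [N [mN N0 PN]]; exists (setT `*` N); split.
- exact: measurableX.
- transitivity (m1 setT * m2 N)%E; first exact: product_measure1E.
  by rewrite [m2 N]N0 mule0.
- by move=> [x y] /= nP; split=> //; exact: PN.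
Qed.

Definition tens (f : T1 -> R) (g : T2 -> R) (x : T1 * T2) := f x.1 * g x.2.

Lemma measurable_tens f g : measurable_fun setT f -> measurable_fun setT g ->
  measurable_fun setT (tens f g).
Proof.
move=> mf mg; apply: measurable_funM.
  by apply: measurableT_comp.
by apply: measurableT_comp.
Qed.

Lemma Lfun2_tens f g : f \in Lfun m1 2%:E -> g \in Lfun m2 2%:E ->
  tens f g \in Lfun m12 2%:E.
Proof.
move=> f2 g2; have mf := Lfun2_measurable f2; have mg := Lfun2_measurable g2.
have mt := measurable_tens mf mg; apply/Lfun2P; split => //.
rewrite (fubini_tonelli1 (fun x => (tens f g x ^+ 2)%:E)); last 2 first.
- exact: measurable_sqr.
- by move=> x; rewrite lee_fin sqr_ge0.
rewrite (eq_integral (fun x => (f x ^+ 2)%:E * \int[m2]_y (g y ^+ 2)%:E)%E).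
  rewrite ge0_integralZr//; last 3 first.
  - exact: measurable_sqr.
  - by move=> x _; rewrite lee_fin sqr_ge0.
  - by apply: integral_ge0 => x _; rewrite lee_fin sqr_ge0.
  by rewrite -!dotpE// -EFinM ltry.
move=> x _; rewrite /fubini_F /tens /=.
under eq_integral do rewrite exprMn EFinM.
rewrite ge0_integralZl_EFin ?sqr_ge0//; last exact: measurable_sqr.
by move=> y _; rewrite lee_fin sqr_ge0.
Qed.

Lemma dotp_tens f g f' g' : f \in Lfun m1 2%:E -> g \in Lfun m2 2%:E ->
  f' \in Lfun m1 2%:E -> g' \in Lfun m2 2%:E ->
  dotp m12 (tens f g) (tens f' g') = dotp m1 f f' * dotp m2 g g'.
Proof.
move=> f2 g2 f'2 g'2.
have it := Lfun2_mul_integrable (Lfun2_tens f2 g2) (Lfun2_tens f'2 g'2).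
rewrite /dotp /Rintegral -(integral12_prod_meas1 it) /fubini_F.
have iff' := Lfun2_mul_integrable f2 f'2.
have igg' := Lfun2_mul_integrable g2 g'2.
have -> : (\int[m1]_x \int[m2]_y (tens f g (x, y) * tens f' g' (x, y))%:E =
    \int[m1]_x ((f x * f' x)%:E * \int[m2]_y (g y * g' y)%:E))%E.
  apply: eq_integral => x _; rewrite -integralZl//; apply: eq_integral => y _.
  by rewrite /= /tens /= -EFinM mulrACA.
have fg := integrable_fin_num measurableT igg'.
have ff := integrable_fin_num measurableT iff'.
by rewrite -(fineK fg) integralZr// -(fineK ff) -EFinM.
Qed.

End ProductMeasure.

Section Swap.
Variable R : realType.
Notation leb := (@lebesgue_measure R).
Notation leb2 := (leb2 R).
Implicit Types f g : R * R -> R.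

(** Conjugation by this map exchanges the two shifts, so the analysis of the series is carried out
    for the first variable only. *)
Definition swap (x : R * R) : R * R := (x.2, x.1).

Let swap' : measurableTypeR R * measurableTypeR R ->
  measurableTypeR R * measurableTypeR R := swap.

Lemma measurable_swap : measurable_fun setT swap'.
Proof. by apply: measurable_fun_pair. Qed.

Lemma measurable_fun_swap f :
  measurable_fun [set: measurableTypeR R * measurableTypeR R] f ->
  measurable_fun [set: measurableTypeR R * measurableTypeR R] (f \o swap).
Proof. by move=> mf; apply: (measurableT_comp mf measurable_swap). Qed.

Lemma integral_sqr_swap f :
  measurable_fun [set: measurableTypeR R * measurableTypeR R] f ->
  (\int[leb2]_x ((f \o swap) x ^+ 2)%:E = \int[leb2]_x (f x ^+ 2)%:E)%E.
Proof.
move=> mf; have mfs := measurable_fun_swap mf.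
rewrite /leb2 (@fubini_tonelli1 _ _ (measurableTypeR R) (measurableTypeR R) R
  leb leb (fun x => ((f \o swap) x ^+ 2)%:E)); last 2 first.
- exact: measurable_sqr.
- by move=> x; rewrite lee_fin sqr_ge0.
rewrite (@fubini_tonelli2 _ _ (measurableTypeR R) (measurableTypeR R) R
  leb leb (fun x => (f x ^+ 2)%:E))//; last 2 first.
- exact: measurable_sqr.
- by move=> x; rewrite lee_fin sqr_ge0.
Qed.

Lemma Lfun2_swap f : f \in Lfun leb2 2%:E -> (f \o swap) \in Lfun leb2 2%:E.
Proof.
move=> /Lfun2P[mf f2]; apply/Lfun2P; split; first exact: measurable_fun_swap.
by rewrite integral_sqr_swap.
Qed.

Lemma normL2E f : normL2 f = sqrte (\int[leb2]_x (f x ^+ 2)%:E)%E.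
Proof. exact: Lnorm2E. Qed.

Lemma normL2_swap f :
  measurable_fun [set: measurableTypeR R * measurableTypeR R] f ->
  normL2 (f \o swap) = normL2 f.
Proof. by move=> mf; rewrite !normL2E integral_sqr_swap. Qed.

Lemma ae_swap (P : R * R -> Prop) :
  {ae leb2, forall x, P x} -> {ae leb2, forall x, P (swap x)}.
Proof.
move=> [N [mN N0 PN]]; exists (swap @^-1` N); split.
- by rewrite -[X in measurable X]setTI; exact: measurable_swap.
- rewrite -N0; transitivity (product_measure2 leb leb N); last first.
    apply/esym.
    by apply: product_measure_unique => // B C mB mC/=; rewrite product_measure2E.
  rewrite /leb2 /= /product_measure1 /product_measure2.
  apply: eq_integral => x _ /=.
  suff -> : xsection (@swap @^-1` N) x = ysection N x by [].
  by apply/seteqP; split => y; rewrite /xsection /ysection /= !inE.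
- by move=> x /= nP; exact: PN.
Qed.

End Swap.

(** * The Haar series defining the shift *)

Section HaarSeries.
Variable R : realType.
Notation leb := (@lebesgue_measure R).
Notation leb2 := (leb2 R).
Notation T2 := (measurableTypeR R * measurableTypeR R)%type.
Implicit Types (u g : R * R -> R) (I K : dyadic).

Definition coef u K (y : R) : R := inner (fun t => u (t, y)) (haar K).

Definition fam1 u I (x : R * R) : R :=
  coef u (dright I) x.2 * haar (dleft I) x.1
  - coef u (dleft I) x.2 * haar (dright I) x.1.

(** Convertible to the summand of [shift2], yet already in conjugated form. *)
Definition fam2 u I (x : R * R) : R := fam1 (u \o @swap R) I (swap x).

Lemma measurable_slice u y : measurable_fun [set: T2] u ->
  measurable_fun [set: measurableTypeR R] (fun t => u (t, y)).
Proof. by move=> mu; apply: (measurableT_comp mu (pair2_measurable y)). Qed.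

(** Tonelli's theorem gives measurability for nonnegative integrands, so the positive and negative
    parts are integrated separately. *)
Lemma measurable_Rintegral_slice u : measurable_fun [set: T2] u ->
  measurable_fun [set: measurableTypeR R]
    (fun y => Rintegral leb setT (fun t => u (t, y))).
Proof.
move=> mu; have mu' : measurable_fun [set: T2] (EFin \o u).
  exact/measurable_EFinP.
rewrite /Rintegral; apply: (@measurableT_comp _ _ _ _ _ _ fine) => //.
pose f : T2 -> \bar R := EFin \o u.
rewrite (_ : (fun _ => _) = (fun y => \int[leb]_t (f ^\+ (t, y))) \-
                            (fun y => \int[leb]_t (f ^\- (t, y))))%E; last first.
  apply/funext => y; rewrite [LHS]integralE.
  congr (_ - _)%E; apply: eq_integral => t _; by rewrite ?funeposE ?funenegE.
apply: emeasurable_funB.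
  apply: (@measurable_fun_fubini_tonelli_G _ _ (measurableTypeR R)
    (measurableTypeR R) R leb (f ^\+)%E) => //.
  exact: measurable_funepos.
apply: (@measurable_fun_fubini_tonelli_G _ _ (measurableTypeR R)
    (measurableTypeR R) R leb (f ^\-)%E) => //.
exact: measurable_funeneg.
Qed.

Lemma measurable_coef u K : measurable_fun [set: T2] u ->
  measurable_fun [set: measurableTypeR R] (coef u K).
Proof.
move=> mu.
apply: (measurable_Rintegral_slice (u := fun x => u x * haar K x.1)).
apply: measurable_funM => //.
by apply: (measurableT_comp (measurable_haar K)).
Qed.

(** Bessel's inequality on each horizontal line, integrated in the other variable by Tonelli. *)
Lemma coef_sum_le u (r : seq dyadic) : uniq r -> measurable_fun [set: T2] u ->
  (\sum_(K <- r) \int[leb]_y (coef u K y ^+ 2)%:E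
     <= \int[leb2]_x (u x ^+ 2)%:E)%E.
Proof.
move=> ur mu; have mc K := measurable_coef K mu.
rewrite -ge0_integral_sum//; last 2 first.
- by move=> K; exact: measurable_sqr.
- by move=> K x _; rewrite lee_fin sqr_ge0.
rewrite /leb2 (@fubini_tonelli2 _ _ (measurableTypeR R) (measurableTypeR R) R
  leb leb (fun x => (u x ^+ 2)%:E)); last 2 first.
- exact: measurable_sqr.
- by move=> x; rewrite lee_fin sqr_ge0.
apply: ge0_le_integral => //.
- by move=> y _; apply: sume_ge0 => K _; rewrite lee_fin sqr_ge0.
- by apply: emeasurable_sum => K; exact: measurable_sqr.
- apply: (@measurable_fun_fubini_tonelli_G _ _ (measurableTypeR R)
    (measurableTypeR R) R leb (fun x => (u x ^+ 2)%:E)).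
    exact: measurable_sqr.
  by move=> x; rewrite lee_fin sqr_ge0.
- move=> y _; rewrite sumEFin.
  apply: (@bessel _ _ _ leb _ r (@haar R) (fun t => u (t, y))) => //.
  + exact: measurable_slice.
  + exact: Lfun2_haar.
  + exact: haar_orthonormal.
Qed.

Lemma Lfun2_coef u K : L2 u -> coef u K \in Lfun leb 2%:E.
Proof.
move=> /Lfun2P[mu u2]; apply/Lfun2P; split; first exact: measurable_coef.
have := @coef_sum_le u [:: K] isT mu; rewrite big_seq1 => h.
exact: le_lt_trans h u2.
Qed.

Lemma fam1E u I : fam1 u I = (fun x =>
  tens (haar (dleft I)) (coef u (dright I)) x -
  tens (haar (dright I)) (coef u (dleft I)) x).
Proof. by apply/funext => x; rewrite /fam1 /tens mulrC [X in _ - X]mulrC. Qed.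

Lemma measurable_fam1 u I : measurable_fun [set: T2] u ->
  measurable_fun [set: T2] (fam1 u I).
Proof.
move=> mu; rewrite fam1E; apply: measurable_funB;
  by apply: measurable_tens; [exact: measurable_haar|exact: measurable_coef].
Qed.

Lemma L2_fam1 u I : L2 u -> fam1 u I \in Lfun leb2 2%:E.
Proof.
move=> u2; rewrite fam1E; apply: Lfun2B;
  by apply: Lfun2_tens; [exact: Lfun2_haar|exact: Lfun2_coef].
Qed.

Lemma child_eq b b' I J : (child b I == child b' J) = (b == b') && (I == J).
Proof. by apply/eqP/andP => [/child_inj[-> ->]|[/eqP-> /eqP->]]. Qed.

Lemma dotp_tens_haar (f g : R -> R) K L : f \in Lfun leb 2%:E -> g \in Lfun leb 2%:E ->
  dotp leb2 (tens (haar K) f) (tens (haar L) g) = (K == L)%:R * dotp leb f g.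
Proof.
move=> f2 g2; rewrite -(haar_orthonormal R K L).
exact: (@dotp_tens _ _ (measurableTypeR R) (measurableTypeR R) R leb leb
  _ _ _ _ (Lfun2_haar R K) f2 (Lfun2_haar R L) g2).
Qed.

Lemma dotp_haar_pair I J (f g f' g' : R -> R) :
  f \in Lfun leb 2%:E -> g \in Lfun leb 2%:E ->
  f' \in Lfun leb 2%:E -> g' \in Lfun leb 2%:E ->
  dotp leb2
    (fun x => tens (haar (dleft I)) f x - tens (haar (dright I)) g x)
    (fun x => tens (haar (dleft J)) f' x - tens (haar (dright J)) g' x) =
  (I == J)%:R * (dotp leb f f' + dotp leb g g').
Proof.
move=> f2 g2 f'2 g'2.
have t2 K h : h \in Lfun leb 2%:E -> tens (haar K) h \in Lfun leb2 2%:E.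
  by move=> h2; apply: Lfun2_tens => //; exact: Lfun2_haar.
rewrite (dotpBB (t2 _ _ f2) (t2 _ _ g2) (t2 _ _ f'2) (t2 _ _ g'2)).
rewrite !dotp_tens_haar//.
have -> : (dleft I == dleft J) = (I == J) by exact: (child_eq false false).
have -> : (dright I == dright J) = (I == J) by exact: (child_eq true true).
have -> : (dleft I == dright J) = false by exact: (child_eq false true).
have -> : (dright I == dleft J) = false by exact: (child_eq true false).
by case: (I == J) => /=; ring.
Qed.

Lemma dotp_fam1 u I J : L2 u -> dotp leb2 (fam1 u I) (fam1 u J) =
  (I == J)%:R * (dotp leb (coef u (dright I)) (coef u (dright J)) +
                 dotp leb (coef u (dleft I)) (coef u (dleft J))).
Proof.
by move=> u2; rewrite !fam1E; apply: dotp_haar_pair; exact: Lfun2_coef.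
Qed.

(** The halves of the members of [A] are pairwise distinct, so the energies of the terms of the
    series form a sum over a duplicate-free list of intervals, to which the Bessel bound applies. *)
Lemma sum_dotp_child_le (c : dyadic -> R -> R) (M : \bar R) (A : {fset dyadic}) :
  (forall K, c K \in Lfun leb 2%:E) ->
  (forall r : seq dyadic, uniq r ->
     (\sum_(K <- r) \int[leb]_y (c K y ^+ 2)%:E <= M)%E) ->
  ((\sum_(K <- A) (dotp leb (c (dright K)) (c (dright K)) +
                   dotp leb (c (dleft K)) (c (dleft K))))%:E <= M)%E.
Proof.
move=> c2 cM; pose r : seq dyadic := map dright A ++ map dleft A.
have ur : uniq r.
  rewrite cat_uniq !map_inj_uniq ?fset_uniq ?andbT/=.
  - apply/hasPn => _ /mapP[K _ ->]; apply/mapP => -[L _].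
    by move=> /(@child_inj false true)[].
  - by move=> K L /(@child_inj false false)[].
  - by move=> K L /(@child_inj true true)[].
apply: le_trans (cM r ur).
under [leRHS]eq_bigr => K _ do rewrite -dotpE//.
by rewrite sumEFin lee_fin big_split big_cat !big_map.
Qed.

Lemma ex_L2sum_fam1 u : L2 u -> exists g, is_L2sum (fam1 u) g.
Proof.
move=> u2; have /Lfun2P[mu u2y] := u2.
have [||g g2 gP] := @orthogonal_series_cvg _ _ R leb2 dyadic (fam1 u)
    (fine (\int[leb2]_x (u x ^+ 2)%:E)%E) (fun I => L2_fam1 I u2).
- by move=> I J /negbTE IJ; rewrite dotp_fam1// IJ mul0r.
- move=> A; rewrite -lee_fin fineK; last first.
    by rewrite ge0_fin_numE//; apply: integral_ge0 => x _; rewrite lee_fin sqr_ge0.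
  under eq_bigr => K _ do rewrite dotp_fam1// eq_refl mul1r.
  apply: sum_dotp_child_le => [K|r ur]; first exact: Lfun2_coef.
  exact: coef_sum_le.
exists g; split => // e e0.
(* The available bound is a large inequality on the squared norm, the required one a strict
   inequality on the norm: hence the half and the square. *)
have e20 : 0 < (e / 2) ^+ 2 by rewrite exprn_gt0// divr_gt0.
have [A0 A0P] := gP _ e20; exists A0 => A /A0P; rewrite normL2E => h.
apply: (@le_lt_trans _ _ (e / 2)%:E).
  rewrite (_ : (e / 2)%:E = sqrte ((e / 2) ^+ 2)%:E) ?lee_sqrt//.
    by rewrite lee_fin sqr_ge0.
  by rewrite /sqrte sqrtr_sqr ger0_norm// ltW// divr_gt0.
by rewrite lte_fin ltr_pdivrMr// ltr_pMr// ltr1n.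
Qed.

Lemma is_L2sum_swap (F : dyadic -> R * R -> R) g :
  (forall I, measurable_fun [set: T2] (F I)) -> is_L2sum F g ->
  is_L2sum (fun I x => F I (swap x)) (g \o @swap R).
Proof.
move=> mF [g2 gP]; split; first exact: Lfun2_swap.
move=> e /gP[A0 A0P]; exists A0 => A /A0P.
rewrite -normL2_swap//; apply: measurable_funB.
  exact: (Lfun2_measurable g2).
by apply: measurable_sum.
Qed.

(** Since a sum exists, the value chosen by [xget] is a genuine sum and not the default 0. *)
Lemma shift1P u : L2 u -> is_L2sum (fam1 u) (shift1 u).
Proof. by move=> u2; apply: (xgetPex (fun=> 0) (ex_L2sum_fam1 u2)). Qed.

Lemma shift2P u : L2 u -> is_L2sum (fam1 (u \o @swap R)) (shift2 u \o @swap R).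
Proof.
move=> u2; have us2 : L2 (u \o @swap R) by exact: Lfun2_swap.
have mf1 I : measurable_fun [set: T2] (fam1 (u \o @swap R) I).
  exact: (Lfun2_measurable (L2_fam1 I us2)).
have mf2 I : measurable_fun [set: T2] (fam2 u I).
  exact: (measurable_fun_swap (mf1 I)).
have : is_L2sum (fam2 u) (shift2 u).
  apply: (xgetPex (fun=> 0)); have [g gP] := ex_L2sum_fam1 us2.
  by exists (g \o @swap R); exact: (is_L2sum_swap mf1 gP).
move=> /(is_L2sum_swap mf2).
by rewrite (_ : (fun I x => _) = fam1 (u \o @swap R)).
Qed.

Lemma L2_shift1 u : L2 u -> L2 (shift1 u).
Proof. by move=> /shift1P[]. Qed.

Lemma L2_shift2 u : L2 u -> L2 (shift2 u).
Proof.
by move=> /shift2P[/Lfun2_swap]; rewrite (_ : _ \o _ = shift2 u)//; apply/funext => -[].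
Qed.

(** The tool for evaluating a shift locally. On [D] every large partial sum may be replaced by [G],
    so the integral of [(g - G)^2] over [D] is bounded by an arbitrarily small squared error. *)
Lemma is_L2sum_ae (F : dyadic -> R * R -> R) g (G : R * R -> R) (D : set T2)
    (A0 : {fset dyadic}) :
  (forall I, measurable_fun [set: T2] (F I)) -> measurable_fun [set: T2] G ->
  measurable D -> is_L2sum F g ->
  (forall A : {fset dyadic}, fsubset A0 A ->
    {ae leb2, forall x, D x -> \sum_(I <- A) F I x = G x}) ->
  {ae leb2, forall x, D x -> g x = G x}.
Proof.
move=> mF mG mD [g2 gP] FG; have mg := Lfun2_measurable g2.
have mgG : measurable_fun [set: T2] (EFin \o (fun x => (g x - G x) ^+ 2)).
  by apply: measurable_sqr; exact: measurable_funB.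
have small (e : R) : 0 < e -> (\int[leb2]_(x in D) ((g x - G x) ^+ 2)%:E <= (e ^+ 2)%:E)%E.
  move=> e0; have [A1 A1P] := gP _ e0; pose A := fsetU A0 A1.
  have mS : measurable_fun [set: T2] (fun x => \sum_(I <- A) F I x).
    exact: measurable_sum.
  have mgS : measurable_fun [set: T2]
      (EFin \o (fun x => (g x - \sum_(I <- A) F I x) ^+ 2)).
    by apply: measurable_sqr; exact: measurable_funB.
  rewrite (@ge0_ae_eq_integral _ _ _ leb2 D _
    (fun x => ((g x - \sum_(I <- A) F I x) ^+ 2)%:E))//; first last.
  - have := FG A (fsubsetUl _ _); apply: filterS => x xP Dx.
    by rewrite xP.
  - by move=> x _; rewrite lee_fin sqr_ge0.
  - by move=> x _; rewrite lee_fin sqr_ge0.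
  - exact: measurable_funTS.
  - exact: measurable_funTS.
  apply: (@le_trans _ _ (\int[leb2]_x ((g x - \sum_(I <- A) F I x) ^+ 2)%:E)%E).
    by apply: ge0_subset_integral => // x _; rewrite lee_fin sqr_ge0.
  have := A1P A (fsubsetUr _ _); rewrite normL2E => /ltW.
  rewrite (_ : e%:E = sqrte (e ^+ 2)%:E); last first.
    by rewrite /sqrte sqrtr_sqr ger0_norm// ltW.
  by rewrite lee_sqrt ?lee_fin ?sqr_ge0//.
have I0 : (\int[leb2]_(x in D) `|((g x - G x) ^+ 2)%:E| = 0)%E.
  under eq_integral do rewrite gee0_abs ?lee_fin ?sqr_ge0//.
  apply/eqP; rewrite eq_le; apply/andP; split; last first.
    by apply: integral_ge0 => x _; rewrite lee_fin sqr_ge0.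
  apply/lee_addgt0Pr => e e0; rewrite add0e.
  have se0 : 0 < Num.sqrt e by rewrite sqrtr_gt0.
  by have := small _ se0; rewrite sqr_sqrtr// ltW.
have := (ae_eq_integral_abs leb2 mD (measurable_funTS mgG)).1 I0.
apply: filterS => x xP /xP[] /eqP; rewrite sqrf_eq0 subr_eq0 => /eqP.
exact.
Qed.

End HaarSeries.

(** * Localization of the shift *)

Section ShiftLocal.
Variable R : realType.
Notation leb := (@lebesgue_measure R).
Notation leb2 := (leb2 R).
Notation T1 := (measurableTypeR R).
Notation T2 := (measurableTypeR R * measurableTypeR R)%type.
Implicit Types (u g : R * R -> R) (I K P Q : dyadic) (s : bool).

Lemma inner_ae (f f' h : R -> R) : measurable_fun [set: T1] f ->
  measurable_fun [set: T1] f' -> measurable_fun [set: T1] h ->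
  {ae leb, forall t, f t * h t = f' t * h t} -> inner f h = inner f' h.
Proof.
move=> mf mf' mh ff'; congr fine; apply: ae_eq_integral => //.
- by apply/measurable_EFinP; exact: measurable_funM.
- by apply/measurable_EFinP; exact: measurable_funM.
- by apply: ae_mono ff' => t /= ft _; rewrite ft.
Qed.

Lemma inner0 (h : R -> R) : inner (fun=> 0) h = 0.
Proof. exact: dotp0l. Qed.

Lemma fam1_child s u Q x : fam1 u Q x =
  sgn R s * coef u (child s Q) x.2 * haar (child (~~ s) Q) x.1 +
  sgn R (~~ s) * coef u (child (~~ s) Q) x.2 * haar (child s Q) x.1.
Proof. by rewrite /fam1; case: s; rewrite /= !mul1r !mulN1r mulNr ?(addrC (- _)). Qed.

Lemma coef_disjoint u I K y : measurable_fun [set: T2] u ->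
  {ae leb, forall t, ~ dset I t -> u (t, y) = 0} ->
  (forall t, dset I t -> ~ @dset R K t) -> coef u K y = 0.
Proof.
move=> mu u0 IK; rewrite -(inner0 (haar K)); apply: inner_ae => //.
- exact: measurable_slice.
- exact: measurable_haar.
- apply: ae_mono u0 => t ut; rewrite mul0r.
  have [tI|tI] := pselect (dset I t); last by rewrite ut// mul0r.
  by rewrite (haar_out (IK _ tI)) mulr0.
Qed.

(** Both [P] and [Q] are the shortest dyadic interval containing [x] and [z]: if one were strictly
    shorter, it would lie in a single half of the other, which separates the two points. *)
Lemma crossing_children s b P Q (x z : R) :
  dset (child (~~ s) P) x -> dset (child (~~ b) Q) x ->
  dset (child s P) z -> dset (child b Q) z -> P = Q.
Proof.
move=> xP xQ zP zQ.
have cl c K : (child c K).1 = K.1 - 1 by case: c.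
have cross c c' K L (t t' : R) : (L.1 < K.1)%R -> dset (child (~~ c) K) t ->
    dset (child (~~ c') L) t -> dset (child c K) t' -> dset (child c' L) t' -> False.
  move=> LK tK tL t'K t'L.
  have LK' : dset L `<=` @dset R (child (~~ c) K).
    apply: (@dset_nest _ _ _ t) => //; last exact: dset_child tL.
    by rewrite cl lerBrDr lezD1.
  have := @dset_childN _ (~~ c) K t'; rewrite negbK; apply=> //.
  by apply: LK'; exact: dset_child t'L.
have [h|h|h] := ltgtP P.1 Q.1.
- by case: (cross _ _ _ _ _ _ h xQ xP zQ zP).
- by case: (cross _ _ _ _ _ _ h xP xQ zP zQ).
- have : child s P = child b Q by apply: (dset_inj _ zP zQ); rewrite !cl h.
  by move=> /child_inj[].
Qed.

(** A nonzero product in the term of [Q] needs one half of [Q] to meet the support of the slice and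
    the other to contain [x.1], so [crossing_children] forces [Q = P]. In the term of [P], the
    product written on [child s P] vanishes at [x.1]. *)
Lemma sum_fam1_sibling u s P (A : {fset dyadic}) x : measurable_fun [set: T2] u ->
  {ae leb, forall t, ~ dset (child s P) t -> u (t, x.2) = 0} ->
  dset (child (~~ s) P) x.1 -> P \in A ->
  \sum_(Q <- A) fam1 u Q x =
  sgn R s * coef u (child s P) x.2 * haar (child (~~ s) P) x.1.
Proof.
move=> mu u0 xP PA; rewrite (big_fsetD1 P)//= (fam1_child s).
rewrite [haar (child s P) _]haar_out ?mulr0 ?addr0; last first.
  by have := @dset_childN _ (~~ s) P x.1 xP; rewrite negbK.
rewrite big_seq big1 ?addr0// => Q; rewrite !inE => /andP[/eqP QP _].
have term0 b : coef u (child b Q) x.2 * haar (child (~~ b) Q) x.1 = 0.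
  have [xQ|/haar_out ->] := pselect (dset (child (~~ b) Q) x.1); last first.
    by rewrite mulr0.
  rewrite (coef_disjoint mu u0) ?mul0r// => t tP tQ.
  by apply: QP; apply/esym; exact: crossing_children xP xQ tP tQ.
by rewrite (fam1_child true) -!mulrA (term0 true) (term0 false) !mulr0 addr0.
Qed.

Lemma fam1_sibling u g s P : measurable_fun [set: T2] u ->
  is_L2sum (fam1 u) g ->
  {ae leb, forall y, {ae leb, forall t, ~ dset (child s P) t -> u (t, y) = 0}} ->
  {ae leb2, forall x, dset (child (~~ s) P) x.1 ->
    g x = sgn R s * coef u (child s P) x.2 * haar (child (~~ s) P) x.1}.
Proof.
move=> mu ug u0.
have mD : measurable (dset (child (~~ s) P) `*` setT : set T2).
  by apply: measurableX => //; exact: measurable_dset.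
have mG : measurable_fun [set: T2]
    (fun x => sgn R s * coef u (child s P) x.2 * haar (child (~~ s) P) x.1).
  apply: measurable_funM.
    apply: measurable_funM => //.
    exact: (measurableT_comp (measurable_coef _ mu)).
  exact: (measurableT_comp (measurable_haar _)).
have := @is_L2sum_ae R _ g _ _ (fset1 P) (fun I => measurable_fam1 I mu) mG mD ug.
move=> h; have {}h : {ae leb2, forall x,
    (dset (child (~~ s) P) `*` setT : set T2) x ->
    g x = sgn R s * coef u (child s P) x.2 * haar (child (~~ s) P) x.1}.
  apply: h => A PA; have := ae_prod_snd leb u0; apply: ae_mono => x ux [xP _].
  by apply: sum_fam1_sibling => //; apply: (fsubsetP PA); rewrite inE.
by apply: ae_mono h => x h xP; exact: h.
Qed.

(** The shift acts on each horizontal line separately, so it does not enlarge the support in the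
    other variable. *)
Lemma fam1_off u g (E : set T1) : measurable_fun [set: T2] u -> measurable E ->
  is_L2sum (fam1 u) g ->
  {ae leb, forall y, ~ E y -> {ae leb, forall t, u (t, y) = 0}} ->
  {ae leb2, forall x, ~ E x.2 -> g x = 0}.
Proof.
move=> mu mE ug u0.
have mD : measurable (setT `*` ~` E : set T2).
  by apply: measurableX => //; exact: measurableC.
have mG : measurable_fun [set: T2] (fun=> 0 : R) by exact: measurable_cst.
have h := @is_L2sum_ae R _ g _ _ fset0 (fun I => measurable_fam1 I mu) mG mD ug.
have {}h : {ae leb2, forall x, (setT `*` ~` E : set T2) x -> g x = 0}.
  apply: h => A _; have := ae_prod_snd leb u0; apply: ae_mono => x ux [_ xE].
  have c0 K : coef u K x.2 = 0.
    rewrite -(inner0 (haar K)); apply: inner_ae => //.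
    - exact: measurable_slice.
    - exact: measurable_haar.
    - by apply: ae_mono (ux xE) => t ->.
  by apply: big1 => Q _; rewrite (fam1_child true) !c0 !mulr0 !mul0r addr0.
by apply: ae_mono h => x h xP; exact: h.
Qed.

(** By orthonormality a single coefficient survives on almost every line, so this formula holds on
    the whole plane and not only over the sibling. *)
Lemma fam1_tens u g s P (v : R -> R) : measurable_fun [set: T2] u ->
  measurable_fun [set: T1] v -> is_L2sum (fam1 u) g ->
  {ae leb2, forall x, u x = haar (child s P) x.1 * v x.2} ->
  {ae leb2, forall x, g x = sgn R s * haar (child (~~ s) P) x.1 * v x.2}.
Proof.
move=> mu mv ug uE.
have mG : measurable_fun [set: T2] (fun x => sgn R s * haar (child (~~ s) P) x.1 * v x.2).
  apply: measurable_funM.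
    apply: measurable_funM => //.
    exact: (measurableT_comp (measurable_haar _)).
  exact: (measurableT_comp mv).
have h := @is_L2sum_ae R _ g _ setT (fset1 P) (fun I => measurable_fam1 I mu) mG measurableT ug.
suff : {ae leb2, forall x, setT x -> g x = sgn R s * haar (child (~~ s) P) x.1 * v x.2}.
  by apply: ae_mono => x; exact.
apply: h => A PA.
have := ae_prod_snd leb (ae_prod_slice2 uE); apply: ae_mono => x ux _.
have cE K : coef u K x.2 = (child s P == K)%:R * v x.2.
  have -> : coef u K x.2 = inner (fun t => v x.2 * haar (child s P) t) (haar K).
    apply: inner_ae.
    - exact: measurable_slice.
    - by apply: measurable_funM => //; exact: measurable_haar.
    - exact: measurable_haar.
    - by apply: ae_mono ux => t ->; rewrite [in RHS](mulrC (v x.2)).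
  rewrite -(haar_orthonormal R) mulrC.
  exact: (dotpZl (v x.2) (Lfun2_haar R _) (Lfun2_haar R _)).
have PA' : P \in A by apply: (fsubsetP PA); rewrite inE.
rewrite (big_fsetD1 P)//= (fam1_child s) !cE !child_eq !eqxx.
rewrite (_ : s == ~~ s = false); last by case: (s).
rewrite /= !mul0r mulr0 mul0r addr0 mul1r.
rewrite big_seq big1 ?addr0; first by rewrite mulrAC.
move=> Q; rewrite !inE => /andP[QP _].
rewrite (fam1_child true) !cE !child_eq [P == Q]eq_sym (negbTE QP) !andbF /=.
by rewrite !mul0r !mulr0 !mul0r addr0.
Qed.

Lemma shift2_sibling u s P : L2 u ->
  {ae leb, forall x, {ae leb, forall t, ~ dset (child s P) t -> u (x, t) = 0}} ->
  {ae leb2, forall x, dset (child (~~ s) P) x.2 ->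
    shift2 u x = sgn R s * inner (fun t => u (x.1, t)) (haar (child s P)) *
      haar (child (~~ s) P) x.2}.
Proof.
move=> u2 u0; have mu := Lfun2_measurable u2.
have := fam1_sibling (measurable_fun_swap mu) (shift2P u2) u0.
by move=> /ae_swap; apply: ae_mono => -[x y].
Qed.

Lemma shift2_off u (E : set T1) : L2 u -> measurable E ->
  {ae leb, forall x, ~ E x -> {ae leb, forall t, u (x, t) = 0}} ->
  {ae leb2, forall x, ~ E x.1 -> shift2 u x = 0}.
Proof.
move=> u2 mE u0; have mu := Lfun2_measurable u2.
have := fam1_off (measurable_fun_swap mu) mE (shift2P u2) u0.
by move=> /ae_swap; apply: ae_mono => -[x y].
Qed.

Lemma shift2_tens u s P (v : R -> R) : L2 u -> measurable_fun [set: T1] v ->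
  {ae leb2, forall x, u x = v x.1 * haar (child s P) x.2} ->
  {ae leb2, forall x, shift2 u x = v x.1 * (sgn R s * haar (child (~~ s) P) x.2)}.
Proof.
move=> u2 mv uE; have mu := Lfun2_measurable u2.
have := fam1_tens (measurable_fun_swap mu) mv (shift2P u2) (s := s) (P := P).
have /[swap]/[apply] : {ae leb2, forall x, (u \o @swap R) x = haar (child s P) x.1 * v x.2}.
  by have := ae_swap uE; apply: ae_mono => -[x y] /= ->; rewrite mulrC.
by move=> /ae_swap; apply: ae_mono => -[x y] /= ->; rewrite mulrC.
Qed.

End ShiftLocal.

(** * Means over dyadic rectangles *)

Section Rectangles.
Variable R : realType.
Notation leb := (@lebesgue_measure R).
Notation leb2 := (leb2 R).
Notation T1 := (measurableTypeR R).
Notation T2 := (measurableTypeR R * measurableTypeR R)%type.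
Implicit Types (b h : R * R -> R) (I J K L : dyadic).

Definition ind J (t : R) : R := \1_(@dset R J) t.

Definition rect K L (x : R * R) : R := tens (ind K) (ind L) x.

Lemma indT J t : dset J t -> ind J t = 1.
Proof. by move=> tJ; rewrite /ind indicE mem_set. Qed.

Lemma indN J t : ~ dset J t -> ind J t = 0.
Proof. by move=> tJ; rewrite /ind indicE memNset. Qed.

Lemma ind_sqr J t : ind J t ^+ 2 = ind J t.
Proof.
by have [/indT ->|/indN ->] := pselect (dset J t); rewrite ?expr1n ?expr0n.
Qed.

Lemma measurable_ind J : measurable_fun [set: T1] (ind J).
Proof. by apply: measurable_indic; exact: measurable_dset. Qed.

Lemma Lfun2_ind J : ind J \in Lfun leb 2%:E.
Proof.
apply/Lfun2P; split; first exact: measurable_ind.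
under eq_integral do rewrite ind_sqr.
by have /integrable_lty := integrable_indic_dset R J; exact.
Qed.

Lemma Lfun2_rect K L : rect K L \in Lfun leb2 2%:E.
Proof. by apply: Lfun2_tens; exact: Lfun2_ind. Qed.

Lemma rect_sqr K L x : rect K L x ^+ 2 = rect K L x.
Proof. by rewrite /rect /tens exprMn !ind_sqr. Qed.

Lemma rectE K L x : rect K L x = \1_(dset K `*` dset L) x.
Proof.
rewrite /rect /tens /ind !indicE /= -natrM mulnb; congr (nat_of_bool _)%:R.
by apply/andP/idP => [[]|]; rewrite !inE.
Qed.

Lemma integral_rect (f : R * R -> R) K L :
  (\int[leb2]_(x in dset K `*` dset L) (f x ^+ 2)%:E =
   \int[leb2]_x ((f x * rect K L x) ^+ 2)%:E)%E.
Proof.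
rewrite integral_mkcond epatch_indic; apply: eq_integral => x _ /=.
by rewrite exprMn rect_sqr rectE EFinM.
Qed.

Definition locally_L2 b := measurable_fun [set: T2] b /\
  forall K L, (fun x => b x * rect K L x) \in Lfun leb2 2%:E.

(** Dyadic rectangles are half-open, so the compact set to use is the product of the closed
    intervals. *)
Lemma L2loc_locally_L2 b : L2loc b -> locally_L2 b.
Proof.
move=> [mb bK]; split => // K L; apply/Lfun2P; split.
  by apply: measurable_funM => //; exact/Lfun2_measurable/Lfun2_rect.
rewrite -integral_rect.
pose cl J : set R := `[J.2%:~R * dlen R J, (J.2 + 1)%:~R * dlen R J]%classic.
have cK J : compact (cl J) by exact: segment_compact.
apply: le_lt_trans (bK _ (compact_setX (cK K) (cK L))).
under [leRHS]eq_integral do rewrite real_normK ?num_real//.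
have dcl J : dset J `<=` cl J.
  by move=> t; rewrite dsetE /cl /= in_itv /= => /andP[-> /ltW].
apply: ge0_subset_integral.
- by apply: measurableX; exact: measurable_dset.
- by apply: measurableX; exact: measurable_itv.
- by apply: measurable_funTS; exact: measurable_sqr.
- by move=> x _; rewrite lee_fin sqr_ge0.
- by move=> x [/= /dcl ? /dcl ?].
Qed.

Lemma locally_L2_swap b : locally_L2 b -> locally_L2 (b \o @swap R).
Proof.
move=> [mb bKL]; split; first exact: measurable_fun_swap.
move=> K L; rewrite (_ : (fun _ => _) = (fun x => b x * rect L K x) \o @swap R).
  exact: Lfun2_swap.
by apply/funext => -[x y]; rewrite /= /rect /tens /= [ind K _ * _]mulrC.
Qed.

Lemma integrable_rect b K L : locally_L2 b ->
  leb2.-integrable setT (EFin \o (fun x => b x * rect K L x)).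
Proof.
move=> [_ bKL].
have := Lfun2_mul_integrable (bKL K L) (Lfun2_rect K L).
by apply: eq_integrable => // x _; rewrite /= -mulrA -expr2 rect_sqr.
Qed.

Lemma ae_integrable_slice b K L : locally_L2 b ->
  {ae leb, forall x, dset K x ->
    leb.-integrable setT (EFin \o (fun y => b (x, y) * ind L y))}.
Proof.
move=> bl.
have := @ae_integrable1 _ _ T1 T1 R leb leb _ (integrable_rect K L bl).
apply: ae_mono => x bx xK; move: bx; apply: eq_integrable => // y _.
by rewrite /= /rect /tens /= indT// mul1r.
Qed.

Lemma Rintegral_dset (f : R -> R) J :
  Rintegral leb (dset J) f = Rintegral leb setT (fun t => f t * ind J t).
Proof. by rewrite Rintegral_mkcond patch_indic. Qed.

Lemma avg2E b L x :
  avg2 b L x = (dlen R L)^-1 * Rintegral leb setT (fun y => b (x, y) * ind L y).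
Proof. by rewrite /avg2 Rintegral_dset. Qed.

Lemma avg1E b K y : avg1 b K y = avg2 (b \o @swap R) K y.
Proof. by []. Qed.

Lemma measurable_avg2 b L : measurable_fun [set: T2] b ->
  measurable_fun [set: T1] (avg2 b L).
Proof.
move=> mb; have -> : avg2 b L = (fun x => (dlen R L)^-1 *
    Rintegral leb setT (fun y => b (x, y) * ind L y)).
  by apply/funext => x; rewrite avg2E.
apply: measurable_funM => //.
apply: (measurable_Rintegral_slice (u := fun x => b (x.2, x.1) * ind L x.1)).
apply: measurable_funM; first exact: (measurable_fun_swap mb).
exact: (measurableT_comp (measurable_ind L)).
Qed.

Lemma avgE b K L : avg b K L = (dlen R K * dlen R L)^-1 *
  Rintegral leb2 setT (fun x => b x * rect K L x).
Proof.
rewrite /avg Rintegral_mkcond patch_indic; congr (_ * _).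
by apply: eq_Rintegral => x _; rewrite rectE.
Qed.

Lemma avg_swap b K L : locally_L2 b -> avg (b \o @swap R) L K = avg b K L.
Proof.
move=> bl; rewrite !avgE [dlen R L * _]mulrC; congr (_ * fine _).
have i1 := integrable_rect L K (locally_L2_swap bl).
have i2 := integrable_rect K L bl.
rewrite -(@integral12_prod_meas1 _ _ T1 T1 R leb leb _ i1).
rewrite -(@integral21_prod_meas1 _ _ T1 T1 R leb leb _ i2).
apply: eq_integral => x _; apply: eq_integral => y _.
by rewrite /= /rect /tens /= [ind K _ * _]mulrC.
Qed.

(* The inner integral may be infinite on a null set, where [fine] is [0]. *)
Lemma avg2_ind b K L x : avg2 b L x * ind K x =
  (dlen R L)^-1 * fine (\int[leb]_y (b (x, y) * rect K L (x, y))%:E)%E.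
Proof.
rewrite avg2E -mulrA; congr (_ * _).
rewrite /rect /tens /=; have [/indT ->|/indN ->] := pselect (dset K x).
  by rewrite mulr1; under [in RHS]eq_integral do rewrite mul1r.
rewrite mulr0; under [in RHS]eq_integral do rewrite mul0r mulr0.
by rewrite integral0.
Qed.

Lemma integrable_fine d (T : measurableType d) (mu : {measure set T -> \bar R})
    (f : T -> \bar R) :
  mu.-integrable setT f -> mu.-integrable setT (EFin \o (fine \o f)).
Proof.
move=> fi; have mf := measurable_int mu fi; apply: le_integrable fi => //.
  by apply/measurable_EFinP; exact: measurableT_comp.
by move=> x _ /=; case: (f x) => [r||] //=; rewrite normr0 leey.
Qed.

Lemma integral_fine d (T : measurableType d) (mu : {measure set T -> \bar R})
    (f : T -> \bar R) : mu.-integrable setT f ->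
  Rintegral mu setT (fine \o f) = fine (\int[mu]_x f x)%E.
Proof.
move=> fi; congr fine; apply: ae_eq_integral => //.
- exact: measurable_int (integrable_fine fi).
- exact: measurable_int fi.
- have := integrable_ae measurableT fi; apply: ae_mono => x fx _ /=.
  by rewrite fineK//; exact: fx.
Qed.

Lemma integrable_avg2 b K L : locally_L2 b ->
  leb.-integrable setT (EFin \o (fun x => avg2 b L x * ind K x)).
Proof.
move=> bl.
have := @integrable_fubini_F _ _ T1 T1 R leb leb _ (integrable_rect K L bl).
move=> /integrable_fine /(integrableZl measurableT (dlen R L)^-1).
by apply: eq_integrable => // x _; rewrite /= avg2_ind.
Qed.

(** Fubini's theorem; the slices on which [fine] replaces an infinite inner integral form a null
    set, absorbed by [integral_fine]. *)
Lemma mean_avg2 b K L : locally_L2 b ->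
  (dlen R K)^-1 * Rintegral leb setT (fun x => avg2 b L x * ind K x) = avg b K L.
Proof.
move=> bl; rewrite avgE invfM -mulrA; congr (_ * _).
have fi := @integrable_fubini_F _ _ T1 T1 R leb leb _ (integrable_rect K L bl).
under eq_Rintegral do rewrite avg2_ind.
rewrite RintegralZl//; last exact: (integrable_fine fi).
congr (_ * _); have := integral_fine fi; rewrite /comp /fubini_F /= => ->.
by rewrite (@integral12_prod_meas1 _ _ T1 T1 R leb leb _ (integrable_rect K L bl)).
Qed.

(** If the right-hand side is infinite there is nothing to prove. Otherwise [(f - c) * ind J] is
    square-integrable, and subtracting its projection [(m - c) * ind J] on [ind J] lowers the energy
    by [(m - c)^2 * dlen R J]. *)
Lemma mean_minimizes (f : R -> R) (m c : R) J : measurable_fun [set: T1] f ->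
  m = (dlen R J)^-1 * Rintegral leb setT (fun t => f t * ind J t) ->
  (\int[leb]_t (((f t - m) * ind J t) ^+ 2)%:E <=
   \int[leb]_t (((f t - c) * ind J t) ^+ 2)%:E)%E.
Proof.
move=> mf mE.
have [fc2|] := ltP (\int[leb]_t (((f t - c) * ind J t) ^+ 2)%:E)%E +oo%E; last first.
  by rewrite leye_eq => /eqP ->; rewrite leey.
have mi := measurable_ind J.
pose g t := (f t - c) * ind J t.
have g2 : g \in Lfun leb 2%:E.
  by apply/Lfun2P; split => //; apply: measurable_funM => //; exact: measurable_funB.
have i2 := Lfun2_ind J.
have gi : dotp leb g (ind J) = (m - c) * dlen R J.
  have ig := Lfun2_mul_integrable g2 i2.
  have ii := Lfun2_mul_integrable i2 i2.
  rewrite mE.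
  have -> : Rintegral leb setT (fun t => f t * ind J t) =
      Rintegral leb setT (fun t => g t * ind J t + c * (ind J t * ind J t)).
    apply: eq_Rintegral => t _.
    by rewrite /g -!mulrA -!expr2 !ind_sqr mulrBl subrK.
  rewrite RintegralD//; last first.
    exact: (integrableZl measurableT c ii).
  rewrite RintegralZl// -[X in _ + c * X]/(dotp leb (ind J) (ind J)).
  have -> : dotp leb (ind J) (ind J) = dlen R J.
    rewrite -[RHS]Rintegral_indic_dset; apply: eq_Rintegral => t _.
    by rewrite -expr2 ind_sqr.
  rewrite -/(dotp leb g (ind J)).
  have lJ : dlen R J != 0 by rewrite gt_eqF ?dlen_gt0.
  by move: (dotp leb g (ind J)) (dlen R J) lJ => X l l0; field.
have ii : dotp leb (ind J) (ind J) = dlen R J.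
  rewrite -[RHS]Rintegral_indic_dset; apply: eq_Rintegral => t _.
  by rewrite -expr2 ind_sqr.
have Zi2 : (fun t => (m - c) * ind J t) \in Lfun leb 2%:E by exact: Lfun2Z.
under eq_integral => t _.
  rewrite (_ : (f t - m) * ind J t = g t - (m - c) * ind J t); last first.
    by rewrite /g -mulrBl opprB addrA subrK.
  over.
pose q := (m - c) * ((m - c) * dlen R J).
have gZ : dotp leb g (fun t => (m - c) * ind J t) = q.
  by rewrite dotpC dotpZl// dotpC gi.
have Zg : dotp leb (fun t => (m - c) * ind J t) g = q by rewrite dotpC.
have ZZ : dotp leb (fun t => (m - c) * ind J t) (fun t => (m - c) * ind J t) = q.
  by rewrite dotpZl// dotpC dotpZl// ii.
rewrite -(dotpE (Lfun2B g2 Zi2)) -(dotpE g2) lee_fin dotpBB// gZ Zg ZZ subrr subr0.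
rewrite gerBl /q mulrA -expr2; apply: mulr_ge0; first exact: sqr_ge0.
by rewrite ltW ?dlen_gt0.
Qed.

(** On a vertical line the competitor [c x.1] is a constant, so [mean_minimizes] applies line by
    line; outside [K] both inner integrals are zero. *)
Lemma rect_mean_minimizes h (m c : R -> R) K L : measurable_fun [set: T2] h ->
  measurable_fun [set: T1] m -> measurable_fun [set: T1] c ->
  {ae leb, forall x, dset K x ->
    m x = (dlen R L)^-1 * Rintegral leb setT (fun y => h (x, y) * ind L y)} ->
  (\int[leb2]_x (((h x - m x.1) * rect K L x) ^+ 2)%:E <=
   \int[leb2]_x (((h x - c x.1) * rect K L x) ^+ 2)%:E)%E.
Proof.
move=> mh mm mc mE.
have mhf (f : R -> R) : measurable_fun [set: T1] f ->
    measurable_fun [set: T2] (EFin \o (fun x => ((h x - f x.1) * rect K L x) ^+ 2)).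
  move=> mf; apply: measurable_sqr; apply: measurable_funM.
    by apply: measurable_funB => //; exact: (measurableT_comp mf).
  exact/Lfun2_measurable/Lfun2_rect.
have sq0 (f : R -> R) (x : T2) : (0 <= (((h x - f x.1) * rect K L x) ^+ 2)%:E)%E.
  by rewrite lee_fin sqr_ge0.
rewrite (@fubini_tonelli1 _ _ T1 T1 R leb leb _ (mhf m mm) (sq0 m)).
rewrite (@fubini_tonelli1 _ _ T1 T1 R leb leb _ (mhf c mc) (sq0 c)).
apply: ae_ge0_le_integral => //.
- by move=> x _; apply: integral_ge0 => y _; rewrite lee_fin sqr_ge0.
- exact: (@measurable_fun_fubini_tonelli_F _ _ T1 T1 R leb _ (mhf m mm) (sq0 m)).
- by move=> x _; apply: integral_ge0 => y _; rewrite lee_fin sqr_ge0.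
- exact: (@measurable_fun_fubini_tonelli_F _ _ T1 T1 R leb _ (mhf c mc) (sq0 c)).
move: mE; apply: ae_mono => x mx _; rewrite /fubini_F /rect /tens /=.
have [xK|/indN ->] := pselect (dset K x); last first.
  under eq_integral do rewrite mul0r mulr0.
  by under [leRHS]eq_integral do rewrite mul0r mulr0.
rewrite indT//; under eq_integral do rewrite mul1r.
under [leRHS]eq_integral do rewrite mul1r.
apply: (mean_minimizes (f := fun y => h (x, y))); last exact: mx.
exact: (measurableT_comp mh (pair1_measurable x)).
Qed.

End Rectangles.

(** * The commutator on a product of sibling intervals *)

Section IteratedCommutator.
Variable R : realType.
Notation leb := (@lebesgue_measure R).
Notation leb2 := (leb2 R).
Notation T1 := (measurableTypeR R).
Notation T2 := (measurableTypeR R * measurableTypeR R)%type.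
Implicit Types (F : R * R -> R) (I J K L P Q : dyadic) (s r : bool).
Variable b : R * R -> R.
Hypothesis bl : locally_L2 b.

Let mb : measurable_fun [set: T2] b. Proof. by case: bl. Qed.

(** The square of the product of two Haar functions is a multiple of [rect K L], which reduces the
    claim to [locally_L2 b]. The equality is only almost everywhere because [F] may be the output of
    a shift, and [c] carries the sign that the shift produces. *)
Lemma L2_mul_tens F (c : R) K L : measurable_fun [set: T2] F ->
  {ae leb2, forall x, F x = (c * haar K x.1) * haar L x.2} -> L2 (mulop b F).
Proof.
move=> mF FE; have mbF : measurable_fun [set: T2] (mulop b F).
  exact: measurable_funM.
apply/Lfun2P; split => //.
pose d := c * Num.sqrt (dlen R K)^-1 * Num.sqrt (dlen R L)^-1.
have d2 : d ^+ 2 = c ^+ 2 * (dlen R K)^-1 * (dlen R L)^-1.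
  by rewrite /d !exprMn !sqr_sqrtr// invr_ge0 ltW ?dlen_gt0.
have bKL2 : (fun x => d * (b x * rect K L x)) \in Lfun leb2 2%:E.
  by apply: Lfun2Z; case: bl.
have /Lfun2P[mbKL] := bKL2.
rewrite (@ge0_ae_eq_integral _ _ _ leb2 setT _ (fun x => (mulop b F x ^+ 2)%:E))//.
- exact: measurable_sqr.
- exact: measurable_sqr.
- by move=> x _; rewrite lee_fin sqr_ge0.
- by move=> x _; rewrite lee_fin sqr_ge0.
move: FE; apply: ae_mono => x Fx _; rewrite /mulop Fx.
congr EFin; rewrite [LHS]exprMn [X in _ * X = _]exprMn rect_sqr d2 /rect /tens.
transitivity (b x ^+ 2 * (c ^+ 2 * haar K x.1 ^+ 2 * haar L x.2 ^+ 2)); last by ring.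
by rewrite !haar_sqr /ind; ring.
Qed.

(** The origin of all the averages: [haar J ^ 2] is the normalized indicator of [J]. *)
Lemma inner_haar_sqr (f : R -> R) (a : R) J :
  leb.-integrable setT (EFin \o (fun t => f t * ind J t)) ->
  inner (fun t => f t * (a * haar J t)) (haar J) =
  a * ((dlen R J)^-1 * Rintegral leb setT (fun t => f t * ind J t)).
Proof.
move=> fi; rewrite mulrA -RintegralZl//; apply: eq_Rintegral => t _.
transitivity (f t * a * haar J t ^+ 2); first by ring.
by rewrite haar_sqr /ind; ring.
Qed.

(** * The inner commutator [[S_2, b]] on a tensor product of Haar functions *)

Section Inner.
Variables (F : R * R -> R) (c : R) (K Q : dyadic) (r : bool).
Hypothesis F2 : L2 F.
Hypothesis FE :
  {ae leb2, forall x, F x = (c * haar K x.1) * haar (child r Q) x.2}.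

Let mF : measurable_fun [set: T2] F. Proof. exact: (Lfun2_measurable F2). Qed.

Let bF2 : L2 (mulop b F). Proof. exact: L2_mul_tens FE. Qed.

Lemma shift2_inner : {ae leb2, forall x, shift2 F x =
  (c * haar K x.1) * (sgn R r * haar (child (~~ r) Q) x.2)}.
Proof.
apply: (shift2_tens F2 (v := fun t => c * haar K t)) => //.
by apply: measurable_funM => //; exact: measurable_haar.
Qed.

Let sF2 : L2 (mulop b (shift2 F)).
Proof.
apply: (@L2_mul_tens _ (c * sgn R r) K (child (~~ r) Q)).
  exact: (Lfun2_measurable (L2_shift2 F2)).
by move: shift2_inner; apply: ae_mono => x ->; ring.
Qed.

Lemma L2_comm : L2 (comm (@shift2 R) (mulop b) F).
Proof. by apply: Lfun2B => //; exact: L2_shift2. Qed.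

(** Here S_2(bF) supplies the average, as the coefficient of b h_J against h_J, and b S_2 F supplies
    [b] itself. The lemma serves twice: for the test function and for its image under [shift1]. *)
Lemma comm_sibling : {ae leb2, forall x, dset (child (~~ r) Q) x.2 ->
  comm (@shift2 R) (mulop b) F x =
  (c * haar K x.1) * (sgn R r * haar (child (~~ r) Q) x.2) *
  (avg2 b (child r Q) x.1 - b x)}.
Proof.
have Fsl := @ae_prod_slice1 _ _ T1 T1 R leb leb _ FE.
have off : {ae leb, forall x, {ae leb, forall t, ~ dset (child r Q) t ->
    mulop b F (x, t) = 0}}.
  move: Fsl; apply: ae_mono => x; apply: ae_mono => t Ft tJ.
  by rewrite /mulop Ft /= (haar_out tJ) !mulr0.
have slice : {ae leb, forall x,
    inner (fun t => mulop b F (x, t)) (haar (child r Q)) =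
    c * haar K x * avg2 b (child r Q) x}.
  move: Fsl (ae_integrable_slice K (child r Q) bl); apply: ae_mono2 => x Fx bx.
  have -> : inner (fun t => mulop b F (x, t)) (haar (child r Q)) =
      inner (fun t => b (x, t) * (c * haar K x * haar (child r Q) t)) (haar (child r Q)).
    apply: inner_ae.
    - exact: (measurable_slice (u := mulop b F \o @swap R) x
        (measurable_fun_swap (Lfun2_measurable bF2))).
    - apply: measurable_funM; first exact: (measurable_slice x (measurable_fun_swap mb)).
      by apply: measurable_funM => //; exact: measurable_haar.
    - exact: measurable_haar.
    - by move: Fx; apply: ae_mono => t Ft; rewrite /mulop Ft.
  (* Integrability of the slice is known only for [x] in [K]; elsewhere the factor [haar K x] makes
     both sides 0. *)
  have [xK|xK] := pselect (dset K x).
    by rewrite inner_haar_sqr ?avg2E//; exact: bx.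
  rewrite (haar_out xK) mulr0 mul0r -[RHS](inner0 (haar (child r Q))).
  by congr inner; apply/funext => t; rewrite mul0r mulr0.
have bFE : {ae leb2, forall x, dset (child (~~ r) Q) x.2 ->
    shift2 (mulop b F) x = sgn R r * (c * haar K x.1 * avg2 b (child r Q) x.1) *
      haar (child (~~ r) Q) x.2}.
  move: (shift2_sibling bF2 off) (@ae_prod_fst _ _ T1 T1 R leb leb _ slice).
  by apply: ae_mono2 => x bFx <-.
move: bFE shift2_inner; apply: ae_mono2 => x bFx sFx xJ.
by rewrite /comm bFx// /mulop sFx; ring.
Qed.

(** Provides the support in the first variable that [fam1_sibling] requires when [shift1] is applied
    to this commutator. *)
Lemma comm_off : {ae leb2, forall x, ~ dset K x.1 ->
  comm (@shift2 R) (mulop b) F x = 0}.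
Proof.
have off : {ae leb, forall x, ~ dset K x -> {ae leb, forall t, mulop b F (x, t) = 0}}.
  have := @ae_prod_slice1 _ _ T1 T1 R leb leb _ FE; apply: ae_mono => x Fx xK.
  by move: Fx; apply: ae_mono => t Ft; rewrite /mulop Ft /= (haar_out xK) mulr0 mul0r mulr0.
have := shift2_off bF2 (@measurable_dset R K) off.
move: shift2_inner; apply: ae_mono2 => x sFx bFx xK.
by rewrite /comm bFx// /mulop sFx (haar_out xK) mulr0 mul0r mulr0 subr0.
Qed.

End Inner.

(** * The outer commutator with [S_1] on the test function *)

Variables (s r : bool) (P Q : dyadic).
Let I := child s P.
Let J := child r Q.
Let I' := child (~~ s) P.
Let J' := child (~~ r) Q.

Let f (x : R * R) : R := haar I x.1 * haar J x.2.

Let f2 : L2 f.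
Proof. by apply: Lfun2_tens; exact: Lfun2_haar. Qed.

Let fE : {ae leb2, forall x, f x = (1 * haar I x.1) * haar J x.2}.
Proof. by apply: aeW => x; rewrite mul1r. Qed.

Let f1E : {ae leb2, forall x, shift1 f x = (sgn R s * haar I' x.1) * haar J x.2}.
Proof.
apply: (fam1_tens _ _ (shift1P f2)).
- exact: (Lfun2_measurable f2).
- exact: measurable_haar.
- by apply: aeW.
Qed.

Let f12 : L2 (shift1 f). Proof. exact: L2_shift1. Qed.

Let u := comm (@shift2 R) (mulop b) f.

Let u2 : L2 u. Proof. exact: (L2_comm f2 fE). Qed.

(** Equal to [avg b I J] by [mean_avg2]; the iterated form is what two successive Haar coefficients
    produce. *)
Let gamma := (dlen R I)^-1 * Rintegral leb setT (fun t => avg2 b J t * ind I t).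

(** On the line at height [y] the commutator is a multiple of [(avg2 b J - b) * haar I], and its
    coefficient on [haar I] averages the first factor over [I]. *)
Lemma coef_comm : {ae leb, forall y, dset J' y ->
  coef u I y = sgn R r * haar J' y * (gamma - avg1 b I y)}.
Proof.
have ub := @ae_prod_slice2 _ _ T1 T1 R leb leb _ (comm_sibling f2 fE).
have bi := ae_integrable_slice J' I (locally_L2_swap bl).
move: ub bi; apply: ae_mono2 => y uy by_ yJ.
have ai := integrable_avg2 I J bl.
have {}by_ := by_ yJ.
have -> : coef u I y = inner (fun t => (avg2 b J t - b (t, y)) *
    (sgn R r * haar J' y * haar I t)) (haar I).
  apply: inner_ae.
  - exact: (measurable_slice y (Lfun2_measurable u2)).
  - apply: measurable_funM.
      apply: measurable_funB; first exact: measurable_avg2.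
      exact: measurable_slice.
    by apply: measurable_funM => //; exact: measurable_haar.
  - exact: measurable_haar.
  - move: uy; apply: ae_mono => t ut; rewrite /u ut//= mul1r.
    by rewrite -/I -/J -/J'; ring.
have di : leb.-integrable setT (EFin \o (fun t => (avg2 b J t - b (t, y)) * ind I t)).
  have := integrableB measurableT ai by_; apply: eq_integrable => // t _.
  by rewrite /= mulrBl.
rewrite inner_haar_sqr//; congr (_ * _).
under eq_Rintegral do rewrite mulrBl.
by rewrite RintegralB// mulrBr avg1E avg2E.
Qed.

Lemma L2_Cit : L2 (Cit b f).
Proof. exact: Lfun2B (L2_shift1 u2) (L2_comm f12 f1E). Qed.

(** The outer shift of the inner commutator gives [gamma] and the average over [I]; the inner
    commutator of [shift1 f], which lives on [I'] in the first variable, gives [b] and the average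
    over [J]. *)
Lemma Cit_sibling : {ae leb2, forall x, dset I' x.1 -> dset J' x.2 ->
  Cit b f x = sgn R s * sgn R r * haar I' x.1 * haar J' x.2 *
    (b x - avg2 b J x.1 - (avg1 b I x.2 - gamma))}.
Proof.
have uoff : {ae leb, forall y, {ae leb, forall t, ~ dset I t -> u (t, y) = 0}}.
  exact: (@ae_prod_slice2 _ _ T1 T1 R leb leb _ (comm_off f2 fE)).
have h1 := fam1_sibling (Lfun2_measurable u2) (shift1P u2) uoff.
have h2 := comm_sibling f12 f1E.
have h3 := @ae_prod_snd _ _ T1 T1 R leb leb _ coef_comm.
have {h1 h3}h1 : {ae leb2, forall x, dset I' x.1 -> dset J' x.2 ->
    shift1 u x = sgn R s * (sgn R r * haar J' x.2 * (gamma - avg1 b I x.2)) * haar I' x.1}.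
  move: h1 h3; apply: ae_mono2 => x ux cx xI xJ.
  by rewrite ux// cx.
move: h1 h2; apply: ae_mono2 => x ux wx xI xJ.
rewrite /Cit {1}/comm ux// wx// -/I' -/J' -/J.
by ring.
Qed.

End IteratedCommutator.

(** * The lower bound *)

Section LowerBound.
Variable R : realType.
Notation leb := (@lebesgue_measure R).
Notation leb2 := (leb2 R).
Notation T1 := (measurableTypeR R).
Notation T2 := (measurableTypeR R * measurableTypeR R)%type.
Implicit Types (b : R * R -> R) (I J K L P Q : dyadic) (s r : bool).

Definition oscillation b K L (x : R * R) : R :=
  b x - avg2 b L x.1 - avg1 b K x.2 + avg b K L.

Lemma measurable_avg1 b K : measurable_fun [set: T2] b ->
  measurable_fun [set: T1] (avg1 b K).
Proof. by move=> mb; exact: (measurable_avg2 K (measurable_fun_swap mb)). Qed.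

(** The intermediate function is [b - avg2 b J - avg1 b K + m]. On vertical lines,
    [avg2 b L - avg b K L] is the mean over [L] of [b - avg1 b K]; on horizontal lines,
    [avg1 b K - m] is the mean over [K] of [b - avg2 b J]. Each comparison is
    [rect_mean_minimizes]. *)
Lemma oscillation_le b K L I J : locally_L2 b ->
  let gamma := (dlen R I)^-1 *
    Rintegral leb setT (fun t => avg2 b J t * ind I t) in
  (\int[leb2]_x ((oscillation b K L x * rect K L x) ^+ 2)%:E <=
   \int[leb2]_x (((b x - avg2 b J x.1 - (avg1 b I x.2 - gamma)) * rect K L x)
     ^+ 2)%:E)%E :> Prop.
Proof.
move=> bl gamma; have [mb _] := bl.
have m1 := measurable_avg1 _ mb; have m2 := measurable_avg2 _ mb.
have fst_m (f : R -> R) : measurable_fun [set: T1] f ->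
    measurable_fun [set: T2] (fun x => f x.1).
  by move=> mf; exact: (measurableT_comp mf).
have snd_m (f : R -> R) : measurable_fun [set: T1] f ->
    measurable_fun [set: T2] (fun x => f x.2).
  by move=> mf; exact: (measurableT_comp mf).
(* This constant is imposed by the second comparison and harmless in the first, whose competitor is
   arbitrary. *)
pose m := (dlen R K)^-1 * Rintegral leb setT (fun t => avg2 b J t * ind K t).
pose h x := b x - avg1 b K x.2.
have mh : measurable_fun [set: T2] h.
  by apply: measurable_funB => //; exact: snd_m.
have step1 : (\int[leb2]_x (((h x - (avg2 b L x.1 - avg b K L)) * rect K L x) ^+ 2)%:E <=
    \int[leb2]_x (((h x - (avg2 b J x.1 - m)) * rect K L x) ^+ 2)%:E)%E.
  apply: (rect_mean_minimizes (m := fun t => avg2 b L t - avg b K L)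
    (c := fun t => avg2 b J t - m) mh).
  - exact: measurable_funB.
  - exact: measurable_funB.
  move: (ae_integrable_slice K L bl); apply: ae_mono => x bx xK.
  have ai := integrable_avg2 L K (locally_L2_swap bl).
  have {}bx := bx xK.
  under eq_Rintegral do rewrite mulrBl.
  rewrite RintegralB// mulrBr -avg2E; congr (_ - _).
  by rewrite -avg_swap// -mean_avg2//; exact: locally_L2_swap.
pose h' x := b x - avg2 b J x.1.
have mh' : measurable_fun [set: T2] h'.
  by apply: measurable_funB => //; exact: fst_m.
have step2 : (\int[leb2]_x (((h' x - (avg1 b K x.2 - m)) * rect K L x) ^+ 2)%:E <=
    \int[leb2]_x (((h' x - (avg1 b I x.2 - gamma)) * rect K L x) ^+ 2)%:E)%E.
  have swapE (c : R -> R) : measurable_fun [set: T1] c ->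
      (\int[leb2]_x (((h' x - c x.2) * rect K L x) ^+ 2)%:E =
       \int[leb2]_x ((((h' \o @swap R) x - c x.1) * rect L K x) ^+ 2)%:E)%E.
    move=> mc; rewrite -(integral_sqr_swap (f := fun x => (h' x - c x.2) * rect K L x)).
      by apply: eq_integral => x _; rewrite /= /rect /tens /= [ind K _ * _]mulrC.
    apply: measurable_funM; last exact/Lfun2_measurable/Lfun2_rect.
    by apply: measurable_funB => //; exact: snd_m.
  have mc1 : measurable_fun [set: T1] (fun t => avg1 b K t - m) by exact: measurable_funB.
  have mc2 : measurable_fun [set: T1] (fun t => avg1 b I t - gamma) by exact: measurable_funB.
  rewrite (swapE _ mc1) (swapE _ mc2).
  apply: (rect_mean_minimizes (measurable_fun_swap mh') mc1 mc2).
  move: (ae_integrable_slice L K (locally_L2_swap bl)); apply: ae_mono => y by_ yL.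
  have ai := integrable_avg2 K J bl.
  have {}by_ := by_ yL.
  rewrite /h' /=; under eq_Rintegral do rewrite mulrBl.
  by rewrite RintegralB// mulrBr avg1E avg2E.
apply: le_trans (le_trans _ step2); last first.
  rewrite le_eqVlt; apply/orP; left; apply/eqP.
  by apply: eq_integral => x _; rewrite /h' opprB.
apply: le_trans (le_trans _ step1) _.
- rewrite le_eqVlt; apply/orP; left; apply/eqP; apply: eq_integral => x _.
  by congr ((_ * _) ^+ 2)%:E; rewrite /oscillation /h; ring.
- rewrite le_eqVlt; apply/orP; left; apply/eqP; apply: eq_integral => x _.
  by congr ((_ * _) ^+ 2)%:E; rewrite /h /h'; ring.
Qed.

(** Scales range over all integers, so a parent always exists; the remainder modulo 2 is
    nonnegative, which covers negative positions too. *)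
Lemma ex_parent I : exists s P, I = child s P.
Proof.
case: I => n k; exists ((k %% 2)%Z == 1), (n + 1, (k %/ 2)%Z).
have k2 := divz_eq k 2; have k0 := modz_ge0 k (isT : (2 : int) != 0).
have k1 := ltz_mod k (isT : (2 : int) != 0).
have nE : n + 1 - 1 = n by rewrite addrK.
have [k21|k20] := eqVneq (k %% 2)%Z 1.
  by rewrite /child /dright /= nE {1}k2 k21.
have {}k20 : (k %% 2)%Z = 0 by move/eqP: k20 k0 k1; lia.
by rewrite /child /dleft /= nE {1}k2 k20 addr0.
Qed.

Lemma oscillation_le_opnorm b K L : locally_L2 b ->
  (sqrte ((dlen R K * dlen R L)^-1%:E *
     \int[leb2]_(x in dset K `*` dset L) (`|oscillation b K L x| ^+ 2)%:E)
   <= opnorm (Cit b))%E.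
Proof.
move=> bl; have [mb _] := bl.
have [s' [P KE]] := ex_parent K; have [r' [Q LE]] := ex_parent L.
(* The given rectangle must be where the commutator is read, so the test function is placed on the
   siblings of its sides. *)
pose s := ~~ s'; pose r := ~~ r'.
have {}KE : K = child (~~ s) P by rewrite negbK.
have {}LE : L = child (~~ r) Q by rewrite negbK.
pose I := child s P; pose J := child r Q.
pose f (x : R * R) := haar I x.1 * haar J x.2 : R.
apply: (@le_trans _ _ (normL2 (Cit b f))); last first.
  apply: ereal_sup_ubound; exists f => //; split.
    exists (fset1 (I, J)), (fun=> 1); apply/funext => x.
    by rewrite big_seq_fset1 mul1r.
  rewrite /= normL2E.
  have f2 : f \in Lfun leb2 2%:E by apply: Lfun2_tens; exact: Lfun2_haar.
  rewrite -dotpE//.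
  have -> : dotp leb2 f f = 1.
    rewrite -[RHS]mulr1.
    rewrite [LHS](@dotp_tens _ _ T1 T1 R leb leb _ _ _ _ (Lfun2_haar R I)
      (Lfun2_haar R J) (Lfun2_haar R I) (Lfun2_haar R J)).
    by rewrite !haar_orthonormal !eqxx.
  by rewrite /sqrte sqrtr1.
have C2 : Cit b f \in Lfun leb2 2%:E by exact: L2_Cit.
have mC := Lfun2_measurable C2.
have lK := dlen_gt0 R K; have lL := dlen_gt0 R L.
have lKL : 0 < dlen R K * dlen R L by rewrite mulr_gt0.
rewrite normL2E lee_sqrt; last first.
  by apply: integral_ge0 => x _; rewrite lee_fin sqr_ge0.
under eq_integral do rewrite real_normK ?num_real//.
rewrite integral_rect muleC lee_pdivrMr//.
apply: (le_trans (oscillation_le K L I J bl)).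
rewrite muleC -ge0_integralZl_EFin//; last 3 first.
- by move=> x _; rewrite lee_fin sqr_ge0.
- exact: measurable_sqr.
- exact: ltW.
set gamma := (dlen R I)^-1 * _.
have mG : measurable_fun [set: T2]
    (fun x => (b x - avg2 b J x.1 - (avg1 b I x.2 - gamma)) * rect K L x).
  apply: measurable_funM; last exact/Lfun2_measurable/Lfun2_rect.
  apply: measurable_funB.
    apply: measurable_funB => //.
    exact: (measurableT_comp (measurable_avg2 J mb)).
  apply: measurable_funB => //.
  exact: (measurableT_comp (measurable_avg1 I mb)).
apply: ae_ge0_le_integral => //.
- by move=> x _; rewrite lee_fin sqr_ge0.
- exact: measurable_sqr.
- by move=> x _; rewrite mule_ge0// lee_fin ?sqr_ge0// ltW.
- by apply: emeasurable_funM => //; exact: measurable_sqr.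
have := Cit_sibling bl s r P Q; rewrite -KE -LE; apply: ae_mono => x Cx _.
rewrite -EFinM lee_fin.
have [xK|/indN xK] := pselect (dset K x.1); last first.
  by rewrite /rect /tens xK mul0r mulr0 expr0n mulr_ge0 ?sqr_ge0// ltW.
have [xL|/indN xL] := pselect (dset L x.2); last first.
  by rewrite /rect /tens xL !mulr0 expr0n mulr_ge0 ?sqr_ge0// ltW.
rewrite (Cx xK xL) -/I -/J -/gamma.
set G := b x - _ - _.
(* On the rectangle the comparison is an equality: the signs square to 1, and the squared Haar
   functions cancel the area. *)
have -> : (sgn R s * sgn R r * haar K x.1 * haar L x.2 * G) ^+ 2 =
    sgn R s ^+ 2 * sgn R r ^+ 2 * haar K x.1 ^+ 2 * haar L x.2 ^+ 2 * G ^+ 2 by ring.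
have sgn2 c : sgn R c ^+ 2 = 1 by case: c; rewrite /= ?sqrrN expr1n.
rewrite !haar_sqr !sgn2 -/(ind K x.1) -/(ind L x.2) /rect /tens !indT// !mulr1 !mul1r.
by rewrite -invfM mulrA divff ?mul1r// gt_eqF.
Qed.

End LowerBound.

Theorem theorem3p2 (R : realType) :
  exists C : R, 0 < C /\
    forall b : R * R -> R, L2loc b -> (BMOrec b <= C%:E * opnorm (Cit b))%E.
Proof.
exists 1; split => // b /L2loc_locally_L2 bl; rewrite mul1e.
(* [BMOrec] takes the root after the supremum, whereas the bound holds for the root on each
   rectangle. Nonnegativity, read off from any one rectangle, excludes the value [-oo] and lets a
   finite norm [n] be written as the root of its square, so that the comparison is made under the
   root. *)
have N0 : (0 <= opnorm (Cit b))%E.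
  by apply: le_trans (oscillation_le_opnorm (0, 0) (0, 0) bl); exact: sqrte_ge0.
rewrite /BMOrec; have := fun p : dyadic * dyadic => oscillation_le_opnorm p.1 p.2 bl.
move: N0; case: (opnorm (Cit b)) => [n||]// n0 nP; last by rewrite leey.
rewrite lee_fin in n0.
have nE : n%:E = sqrte (n ^+ 2)%:E by rewrite /sqrte sqrtr_sqr ger0_norm.
rewrite nE lee_sqrt ?lee_fin ?sqr_ge0//.
apply: ge_ereal_sup => _ [p _ <-].
by have := nP p; rewrite nE lee_sqrt ?lee_fin ?sqr_ge0.
Qed.
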